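(* Let $G$ be a discrete group and $\sigma$ a multiplier on $G$. If the full twisted group $C^*$-algebra $C^*(G,\sigma)$ is prime, then $(G,\sigma)$ satisfies condition K.
   Context: A multiplier on a discrete group $G$ (identity $e$) is a function $\sigma:G\times G\to\mathbb{T}$ with $\sigma(a,b)\sigma(ab,c)=\sigma(a,bc)\sigma(b,c)$ and $\sigma(a,e)=\sigma(e,a)=1$ for all $a,b,c\in G$. The Banach $^*$-algebra $\ell^1(G,\sigma)$ is $\ell^1(G)$ with the $\|\cdot\|_1$-norm, product $(f*_\sigma g)(a)=\sum_{b\in G}f(b)\sigma(b,b^{-1}a)g(b^{-1}a)$ and involution $f^*(a)=\overline{\sigma(a,a^{-1})}\,\overline{f(a^{-1})}$. The full twisted group $C^*$-algebra $C^*(G,\sigma)$ is the universal enveloping $C^*$-algebra of $\ell^1(G,\sigma)$. An element $a\in G$ is $\sigma$-regular if $\sigma(a,b)=\sigma(b,a)$ whenever $b\in G$ commutes with $a$. If $a$ is $\sigma$-regular then so is every conjugate of $a$, so one speaks of $\sigma$-regular conjugacy classes. The pair $(G,\sigma)$ satisfies condition K if every nontrivial (i.e. $\neq\{e\}$) $\sigma$-regular conjugacy class of $G$ is infinite. A $C^*$-algebra is prime if any two nonzero (closed two-sided) ideals have nonzero intersection. *)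

(* Defs.v *)
From HB Require Import structures.
From mathcomp Require Import all_boot all_order all_algebra.
From mathcomp Require Import complex.
From mathcomp Require Import all_classical all_reals all_analysis.

Set Implicit Arguments.
Unset Strict Implicit.
Unset Printing Implicit Defensive.

Import Order.TTheory GRing.Theory Num.Theory.
Import numFieldNormedType.Exports.

Local Open Scope classical_set_scope.
Local Open Scope complex_scope.
Local Open Scope ring_scope.

(* The axioms are required only in isCStarAlgebra below, so that the
   convolution algebra ell1 and C*-algebras share the notion of star_hom. *)
HB.mixin Record hasMulStar (R : realType) V & GRing.Lmodule R[i] V := {
  amul : V -> V -> V;
  astar : V -> V
}.

#[short(type="mulStarType")]
HB.structure Definition MulStar (R : realType) :=
  {V of GRing.Lmodule R[i] V & hasMulStar R V}.

(* Norms on R[i]-modules take values in R[i] (in its nonnegative reals). *)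
HB.mixin Record isCStarAlgebra (R : realType) V
    & CompleteNormedModule R[i] V & hasMulStar R V := {
  amulA : associative (amul : V -> V -> V);
  amulDl : left_distributive (amul : V -> V -> V) +%R;
  amulDr : right_distributive (amul : V -> V -> V) +%R;
  amulZl : forall (k : R[i]) (x y : V), amul (k *: x) y = k *: amul x y;
  amulZr : forall (k : R[i]) (x y : V), amul x (k *: y) = k *: amul x y;
  astarK : involutive (astar : V -> V);
  astarD : {morph (astar : V -> V) : x y / x + y};
  astarZ : forall (k : R[i]) (x : V), astar (k *: x) = k^* *: astar x;
  astarM : forall x y : V, astar (amul x y) = amul (astar y) (astar x);
  norm_amul : forall x y : V, `|amul x y| <= `|x| * `|y|;
  cstar_norm : forall x : V, `|amul (astar x) x| = `|x| ^+ 2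
}.

#[short(type="cstarAlgType")]
HB.structure Definition CStarAlgebra (R : realType) :=
  {V of CompleteNormedModule R[i] V & hasMulStar R V & isCStarAlgebra R V}.

Section star_homomorphisms.
Variable R : realType.

Definition star_hom (U V : mulStarType R) (phi : U -> V) : Prop :=
  [/\ linear phi,
      {morph phi : x y / amul x y} &
      {morph phi : x / astar x}].

(* (A, iota) is universal among star-homomorphisms from L to C*-algebras.
   C*-algebras and homomorphisms need not be unital, and no continuity of rho is
   required: star-homomorphisms from a Banach star-algebra to a C*-algebra are
   contractive. *)
Definition enveloping_cstar (L : mulStarType R) (A : cstarAlgType R)
    (iota : L -> A) : Prop :=
  star_hom iota /\
  forall (B : cstarAlgType R) (rho : L -> B), star_hom rho ->
    exists! phi : A -> B, star_hom phi /\ phi \o iota = rho.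

Definition closed_ideal (A : cstarAlgType R) (I : set A) : Prop :=
  [/\ closed I,
      I 0,
      (forall x y, I x -> I y -> I (x + y)),
      (forall (k : R[i]) x, I x -> I (k *: x)) &
      (forall a x, I x -> I (amul a x) /\ I (amul x a))].

Definition prime_cstar (A : cstarAlgType R) : Prop :=
  forall I J : set A, closed_ideal I -> closed_ideal J ->
    I <> [set 0] -> J <> [set 0] -> I `&` J <> [set 0].

End star_homomorphisms.

Record multiplier (R : realType) (G : groupType) := Multiplier {
  mult_fun :> G -> G -> R[i];
  mult_norm1 : forall a b, `|mult_fun a b| = 1;
  mult_cocycle : forall a b c,
    mult_fun a b * mult_fun (a * b)%g c = mult_fun a (b * c)%g * mult_fun b c;
  mult1r : forall a, mult_fun a 1%g = 1;
  mult1l : forall a, mult_fun 1%g a = 1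
}.

Section unordered_sums.
Variables (R : realType) (T : choiceType).

(* Meaningful for absolutely summable families *)
Definition rsum (u : T -> R) : R :=
  fine (\esum_(x in [set: T]) ((EFin \o u)^\+ x))%E
  - fine (\esum_(x in [set: T]) ((EFin \o u)^\- x))%E.

Definition csum (u : T -> R[i]) : R[i] :=
  (rsum (fun x => complex.Re (u x))) +i* (rsum (fun x => complex.Im (u x))).

Definition ell1_norm (u : T -> R[i]) : \bar R :=
  (\esum_(x in [set: T]) (Normc.normc (u x))%:E)%E.

Let normc_ge0 (z : R[i]) : 0 <= Normc.normc z.
Proof. by case: z => a b; exact: sqrtr_ge0. Qed.

Let normc_leD (z : R[i]) : Normc.normc z <= `|complex.Re z| + `|complex.Im z|.
Proof.
case: z => a b /=.
rewrite -[leRHS]ger0_norm ?addr_ge0// -sqrtr_sqr ler_wsqrtr//.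
by rewrite sqrrD !real_normK ?num_real// lerD2r lerDl mulrn_wge0 ?mulr_ge0.
Qed.

Let Re_le_normc (z : R[i]) : `|complex.Re z| <= Normc.normc z.
Proof. by case: z => a b /=; rewrite -sqrtr_sqr ler_wsqrtr// lerDl sqr_ge0. Qed.

Let Im_le_normc (z : R[i]) : `|complex.Im z| <= Normc.normc z.
Proof. by case: z => a b /=; rewrite -sqrtr_sqr ler_wsqrtr// lerDr sqr_ge0. Qed.

Lemma norm1_ge0 u : (0 <= ell1_norm u)%E.
Proof. by apply: esum_ge0 => x _; rewrite lee_fin. Qed.

Lemma norm1D u v : (ell1_norm (u + v)%R <= ell1_norm u + ell1_norm v)%E.
Proof.
rewrite /ell1_norm -esumD; [|by move=> x _; rewrite lee_fin..].
by apply: le_esum => x _; rewrite -EFinD lee_fin le_normcD.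
Qed.

Lemma esumZl_le (c : R) (f : T -> \bar R) : 0 <= c -> (forall x, 0 <= f x)%E ->
  (\esum_(x in [set: T]) (c%:E * f x) <= c%:E * \esum_(x in [set: T]) f x)%E.
Proof.
move=> c0 f0; apply: ge_ereal_sup => _ [A [finA _]] <-.
rewrite -ge0_mule_fsumr//; apply: lee_wpmul2l; first by rewrite lee_fin.
by apply: ereal_sup_ubound; exists A.
Qed.

Lemma norm1Z (k : R[i]) u : (ell1_norm (k *: u)%R <= (Normc.normc k)%:E * ell1_norm u)%E.
Proof.
apply: le_trans (esumZl_le (normc_ge0 k) _); last by move=> x; rewrite lee_fin.
by apply: le_esum => x _; rewrite -EFinM -Normc.normcM lexx.
Qed.

Let rsum_le (w : T -> R) (u : T -> R[i]) :
  (forall x, `|w x| <= Normc.normc (u x)) ->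
  ((`|rsum w|)%:E <= ell1_norm u + ell1_norm u)%E.
Proof.
move=> wu.
have fine_le (x : \bar R) : (0 <= x -> (fine x)%:E <= x)%E.
  by case: x => //= x _; rewrite leey.
have p0 : (0 <= \esum_(x in [set: T]) (EFin \o w)^\+ x)%E by exact: esum_ge0.
have n0 : (0 <= \esum_(x in [set: T]) (EFin \o w)^\- x)%E by exact: esum_ge0.
have pu : (\esum_(x in [set: T]) (EFin \o w)^\+ x <= ell1_norm u)%E.
  apply: le_esum => x _; rewrite funeposE /= -EFin_max lee_fin ge_max normc_ge0.
  by rewrite andbT; apply: le_trans (wu x); exact: ler_norm.
have nu : (\esum_(x in [set: T]) (EFin \o w)^\- x <= ell1_norm u)%E.
  apply: le_esum => x _; rewrite funenegE /= -EFin_max lee_fin ge_max normc_ge0.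
  by rewrite andbT; apply: le_trans (wu x); rewrite -normrN; exact: ler_norm.
have := leeD (le_trans (fine_le _ p0) pu) (le_trans (fine_le _ n0) nu).
rewrite -EFinD; apply: le_trans; rewrite lee_fin /rsum.
by rewrite (le_trans (ler_normB _ _))// !ger0_norm ?fine_ge0.
Qed.

Lemma csum_le u : ((Normc.normc (csum u))%:E <= 4%:E * ell1_norm u)%E.
Proof.
apply: (@le_trans _ _ ((ell1_norm u + ell1_norm u) + (ell1_norm u + ell1_norm u))%E).
  apply: (@le_trans _ _
    ((`|complex.Re (csum u)|)%:E + (`|complex.Im (csum u)|)%:E)%E).
    by rewrite -EFinD lee_fin normc_leD.
  by apply: leeD; apply: rsum_le => x.
move: (norm1_ge0 u); case: (ell1_norm u) => [r||]// r0.
  by rewrite -!EFinD -EFinM lee_fin [leRHS]mulr_natl -!mulr2n -mulrnA.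
by rewrite mulry gtr0_sg// mul1e.
Qed.

Lemma esum_swap_le (f : T -> T -> \bar R) : (forall x y, 0 <= f x y)%E ->
  (\esum_(x in [set: T]) \esum_(y in [set: T]) f x y <=
   \esum_(y in [set: T]) \esum_(x in [set: T]) f x y)%E.
Proof.
move=> f0; rewrite !esum_esum//.
rewrite (@reindex_esum _ _ _ ([set: T] `*`` fun=> [set: T])
  ([set: T] `*`` fun=> [set: T]) (fun z : T * T => (z.2, z.1)))//.
split=> [[x y]//|[x y] [x' y'] _ _ /= [-> ->]//|[x y] _ /=].
by exists (y, x).
Qed.

End unordered_sums.

Section ell1_space.
Variables (R : realType) (G : groupType).

Definition in_ell1 : {pred (G -> R[i])} := fun u => (ell1_norm u < +oo)%E.

Fact in_ell1_submod : subsemimod_closed in_ell1.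
Proof.
split; first split.
- apply: le_lt_trans (ltry 0); rewrite /ell1_norm esum1// => x _.
  by rewrite Normc.normc0.
- by move=> u v u1 v1; apply: le_lt_trans (norm1D u v) (lte_add_pinfty u1 v1).
- move=> k u u1; apply: le_lt_trans (norm1Z k u) _.
  by apply: lte_mul_pinfty => //; rewrite lee_fin; case: k => a b; exact: sqrtr_ge0.
Qed.

HB.instance Definition _ :=
  GRing.isSubmodClosed.Build R[i] (G -> R[i]) in_ell1 in_ell1_submod.

Definition twisted_conv (sigma : multiplier R G) (u v : G -> R[i]) : G -> R[i] :=
  fun a => csum (fun b => u b * sigma b (b^-1 * a)%g * v (b^-1 * a)%g).

Definition twisted_star (sigma : multiplier R G) (u : G -> R[i]) : G -> R[i] :=
  fun a => (sigma a a^-1%g)^* * (u a^-1%g)^*.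

Let normc_mult (sigma : multiplier R G) a b : Normc.normc (sigma a b) = 1.
Proof.
by have := mult_norm1 sigma a b; rewrite normc_def; case: (sigma a b) => x y /= [].
Qed.

Let normc_ge0 (z : R[i]) : 0 <= Normc.normc z.
Proof. by case: z => a b; exact: sqrtr_ge0. Qed.

Lemma twisted_conv_in_ell1 sigma u v :
  u \in in_ell1 -> v \in in_ell1 -> twisted_conv sigma u v \in in_ell1.
Proof.
rewrite /in_ell1 !unfold_in => u1 v1.
pose F a b := ((Normc.normc (u b))%:E * (Normc.normc (v (b^-1 * a)%g))%:E)%E.
have F0 a b : (0 <= F a b)%E by rewrite /F -EFinM lee_fin mulr_ge0.
have vfin : ell1_norm v \is a fin_num by rewrite ge0_fin_numE ?norm1_ge0.
have FE b : (\esum_(a in [set: G]) F a b <=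
             (fine (ell1_norm v))%:E * (Normc.normc (u b))%:E)%E.
  rewrite muleC fineK//; apply: le_trans (esumZl_le (normc_ge0 _) _) _.
    by move=> x; rewrite lee_fin.
  apply: lee_wpmul2l; first by rewrite lee_fin.
  rewrite /ell1_norm [leRHS](@reindex_esum _ _ _ [set: G] [set: G]
    (fun a => (b^-1 * a)%g))//.
  split=> [//|x y _ _ /mulgI//|x _ /=].
  by exists (b * x)%g => //; rewrite mulKg.
have convE a : ((Normc.normc (twisted_conv sigma u v a))%:E <=
                4%:E * \esum_(b in [set: G]) F a b)%E.
  apply: le_trans (csum_le _) _; apply: lee_wpmul2l => //.
  apply: le_esum => b _.
  by rewrite !Normc.normcM normc_mult mulr1 EFinM lexx.
apply: (@le_lt_trans _ _ (4%:E * ((fine (ell1_norm v))%:E * ell1_norm u))%E).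
  apply: le_trans (le_esum (fun a _ => convE a)) _.
  apply: le_trans (esumZl_le (ler0n _ 4) _) _.
    by move=> a; apply: esum_ge0.
  apply: lee_wpmul2l => //; apply: le_trans (esum_swap_le F0) _.
  apply: le_trans (le_esum (fun b _ => FE b)) _.
  by apply: esumZl_le => [|x]; [exact/fine_ge0/norm1_ge0|rewrite lee_fin].
by rewrite !lte_mul_pinfty// lee_fin fine_ge0// norm1_ge0.
Qed.

Lemma twisted_star_in_ell1 sigma u : u \in in_ell1 -> twisted_star sigma u \in in_ell1.
Proof.
rewrite /in_ell1 !unfold_in; apply: le_lt_trans; rewrite /ell1_norm.
rewrite [leRHS](@reindex_esum _ _ _ [set: G] [set: G] (fun a : G => (a^-1)%g)).
  have normcJ (z : R[i]) : Normc.normc z^* = Normc.normc z.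
    by case: z => x y; rewrite /= sqrrN.
  by apply: le_esum => a _; rewrite Normc.normcM !normcJ normc_mult mul1r.
by split=> [//|x y _ _ /invg_inj//|x _ /=]; exists x^-1%g => //; rewrite invgK.
Qed.

End ell1_space.

Record ell1 (R : realType) (G : groupType) (sigma : multiplier R G) := Ell1 {
  ell1_val :> G -> R[i];
  ell1P : ell1_val \in @in_ell1 R G
}.

HB.instance Definition _ R G sigma := [isSub for @ell1_val R G sigma].
HB.instance Definition _ R G sigma := [Choice of @ell1 R G sigma by <:].
HB.instance Definition _ R G sigma :=
  [SubChoice_isSubLmodule of @ell1 R G sigma by <:].
HB.instance Definition _ (R : realType) (G : groupType) (sigma : multiplier R G) :=
  hasMulStar.Build R (ell1 sigma)
    (fun f g => Ell1 sigma (twisted_conv_in_ell1 sigma (ell1P f) (ell1P g)))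
    (fun f => Ell1 sigma (twisted_star_in_ell1 sigma (ell1P f))).

(* C*(G, sigma) is determined up to isomorphism by this property: A, together
   with the canonical map iota, is a model of it. *)
Definition full_twisted_group_cstar (R : realType) (G : groupType)
    (sigma : multiplier R G) (A : cstarAlgType R) (iota : ell1 sigma -> A) :
  Prop := enveloping_cstar iota.

Section condition_K.
Variables (R : realType) (G : groupType) (sigma : multiplier R G).

Definition sigma_regular (a : G) : Prop :=
  forall b : G, commute a b -> sigma a b = sigma b a.

Definition conj_class (a : G) : set G := [set (a ^ g)%g | g in [set: G]].

(* Regularity is invariant under conjugation, so regular classes are the
   classes of regular elements. *)
Definition conditionK : Prop :=
  forall a : G, sigma_regular a -> conj_class a <> [set 1%g] ->
    infinite_set (conj_class a).

End condition_K.

(* Main.v *)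
Require Import Defs.
From HB Require Import structures.
From mathcomp Require Import all_boot all_order all_algebra.
From mathcomp Require Import complex finmap.
From mathcomp Require Import all_classical all_reals all_analysis.
From mathcomp Require Import ring lra.

Set Implicit Arguments.
Unset Strict Implicit.
Unset Printing Implicit Defensive.

Import Order.TTheory GRing.Theory Num.Theory.
Import numFieldNormedType.Exports.

Local Open Scope classical_set_scope.
Local Open Scope complex_scope.
Local Open Scope ring_scope.

(** Suppose that a nontrivial sigma-regular conjugacy class is finite, and let
    a be one of its elements. Adding up the distinct twisted conjugates of the
    point mass at a gives an element f of l1(G, sigma) supported on the class;
    regularity of a is what makes the coefficient of f at a ^ g independent of
    the choice of g (class_coef_indep), and f commutes with every element of
    l1(G, sigma) (class_elt_central). So z = iota f commutes with the image of
    iota. It is not a multiple of the unit: the left regular representation on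
    l2(G) factors through A, and it tells f from the multiples of the point mass
    at 1 by a matrix entry. On the other hand, when A is prime, only
    the scalars commute with the image of iota (prime_rigid_scalar), which is
    the contradiction.

    The universal property of A enters the second half as rigidity: a star
    endomorphism of A that fixes the image of iota is the identity. Applied to
    the reflection x |-> (1 - 2e) x (1 - 2e), where e is the image of the point
    mass at 1, it shows that e is a unit (rigid_unit); applied to x |-> u x u*
    it shows that a unitary u commuting with the image of iota is central
    (rigid_inner). A self-adjoint contraction w is the imaginary part of the
    unitary u = sqrt (e - w ^ 2) + i w, so everything that commutes with the
    image of iota is central (rigid_central).

    In a prime algebra a nonzero central self-adjoint element is no zero divisor,
    because its annihilator is an ideal, and so is the annihilator of that ideal
    (prime_central_mul_eq0). Let z be central and self-adjoint, let t be real
    and let w = z - t e. If s is a square root of w ^ 2 with norm of e - s at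
    most 1, then (s - w)(s + w) = 0, so w is s or - s: one of e - w and e + w
    lies in the unit ball (prime_central_sign). By the intermediate value
    theorem some t gives e - w and e + w the same norm; then both lie in the
    unit ball, and w = 0 because e is an extreme point of that ball
    (unit_extreme).

    No spectral theory is involved. In place of positivity of x the proof uses
    that x is a square or that e - x lies in the unit ball, and the passage
    between the two is the square root of e - x for x in the unit ball
    (exists_sqrt), obtained by an iteration that converges in norm and is
    dominated by the same iteration in the reals.

    The regular representation requires the C*-algebra of bounded operators on
    l2(T). It is realised as the algebra of matrices all of whose finite
    corners are uniformly bounded: sums, norms and completeness then concern
    finite sums only, the product of matrices is an absolutely convergent
    series, and the regular representation is multiplicative by a change of
    variable in a single sum. *)

(** * Norms and commutation in C*-algebras *)

Lemma gt0_complexR (R : rcfType) (e : R[i]) : 0 < e ->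
  exists2 r : R, e = r%:C & 0 < r.
Proof. by case: e => a b; rewrite ltcE /= => /andP[/eqP -> a0]; exists a. Qed.

Lemma two_neq0 (R : rcfType) : (2 : R)%:C != 0 :> R[i].
Proof. by rewrite eq_complex /= pnatr_eq0. Qed.

Lemma conjCE (R : rcfType) (k : R[i]) : (k^*)%R = conjc k.
Proof. by []. Qed.

Section cstar_norm.
Variables (R : realType) (A : cstarAlgType R).
Implicit Types (x y z : A) (k : R[i]).

(** The norm of a module over R[i] is complex-valued; its real part is used
    instead, so that total order arguments apply. *)
Definition nrm x : R := complex.Re `|x|.

Lemma nrmE x : `|x| = (nrm x)%:C.
Proof.
rewrite /nrm; have := normr_ge0 x; case: `|x| => a b /=.
by rewrite lecE /= => /andP[/eqP -> _].
Qed.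

Lemma nrm_ge0 x : 0 <= nrm x.
Proof. by have := normr_ge0 x; rewrite nrmE lecR. Qed.

Lemma nrm0 : nrm 0 = 0.
Proof. by rewrite /nrm normr0. Qed.

Lemma nrm_eq0 x : nrm x = 0 -> x = 0.
Proof. by move=> x0; apply/eqP; rewrite -normr_eq0 nrmE x0. Qed.

Lemma nrmN x : nrm (- x) = nrm x.
Proof. by rewrite /nrm normrN. Qed.

Lemma nrmD x y : nrm (x + y) <= nrm x + nrm y.
Proof. by have := ler_normD x y; rewrite !nrmE -rmorphD /= lecR. Qed.

Lemma nrmB x y : nrm (x - y) <= nrm x + nrm y.
Proof. by rewrite -(nrmN y) nrmD. Qed.

Lemma nrm_distC x y : nrm (x - y) = nrm (y - x).
Proof. by rewrite -nrmN opprB. Qed.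

Lemma nrmZ (r : R) x : nrm (r%:C *: x) = `|r| * nrm x.
Proof.
apply: complexI; rewrite -nrmE normrZ nrmE rmorphM /=; congr (_ * _).
by rewrite normc_def /= expr0n addr0 sqrtr_sqr.
Qed.

Lemma nrmM x y : nrm (amul x y) <= nrm x * nrm y.
Proof. by have := norm_amul x y; rewrite !nrmE -rmorphM /= lecR. Qed.

Lemma nrm_cstar x : nrm (amul (astar x) x) = nrm x ^+ 2.
Proof. by apply: complexI; rewrite -nrmE cstar_norm nrmE rmorphXn. Qed.

Lemma nrm_star x : nrm (astar x) = nrm x.
Proof.
suff le_star y : nrm y <= nrm (astar y).
  by apply/eqP; rewrite eq_le le_star andbT -{2}(astarK x) le_star.
have := nrmM (astar y) y; rewrite nrm_cstar expr2.
have [y0|y0] := eqVneq (nrm y) 0; first by rewrite y0 nrm_ge0.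
by rewrite ler_pM2r // lt_neqAle eq_sym y0 nrm_ge0.
Qed.

Lemma amul0l x : amul 0 x = 0.
Proof. by have := amulZl 0 0 x; rewrite !scale0r. Qed.

Lemma amul0r x : amul x 0 = 0.
Proof. by have := amulZr 0 x 0; rewrite !scale0r. Qed.

Lemma amulNl x y : amul (- x) y = - amul x y.
Proof. by have := amulZl (-1) x y; rewrite !scaleN1r. Qed.

Lemma amulNr x y : amul x (- y) = - amul x y.
Proof. by have := amulZr (-1) x y; rewrite !scaleN1r. Qed.

Lemma amulBl x y z : amul (x - y) z = amul x z - amul y z.
Proof. by rewrite amulDl amulNl. Qed.

Lemma amulBr x y z : amul z (x - y) = amul z x - amul z y.
Proof. by rewrite amulDr amulNr. Qed.

Lemma astar0 : astar (0 : A) = 0.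
Proof. by have := astarZ 0 (0 : A); rewrite rmorph0 !scale0r. Qed.

Lemma astarN x : astar (- x) = - astar x.
Proof. by have := astarZ (-1) x; rewrite rmorphN1 !scaleN1r. Qed.

Lemma astarB x y : astar (x - y) = astar x - astar y.
Proof. by rewrite astarD astarN. Qed.

Lemma astarZR (r : R) x : astar (r%:C *: x) = r%:C *: astar x.
Proof.
rewrite astarZ. congr (_ *: _).  by rewrite conjCE conjc_real. Qed.

Lemma astarZi x : astar ('i *: x) = - ('i *: astar x).
Proof.
rewrite astarZ conjCE -scaleNr; congr (_ *: _).
by apply/eqP; rewrite eq_complex /= oppr0 !eqxx. Qed.

Definition acomm x y := amul x y = amul y x.

Lemma acomm_sym x y : acomm x y -> acomm y x.
Proof. by []. Qed.

Lemma acomm0 x : acomm x 0.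
Proof. by rewrite /acomm amul0r amul0l. Qed.

Lemma acommD x y z : acomm x y -> acomm x z -> acomm x (y + z).
Proof. by rewrite /acomm amulDr amulDl => -> ->. Qed.

Lemma acommN x y : acomm x y -> acomm x (- y).
Proof. by rewrite /acomm amulNr amulNl => ->. Qed.

Lemma acommB x y z : acomm x y -> acomm x z -> acomm x (y - z).
Proof. by move=> xy xz; apply: acommD => //; exact: acommN. Qed.

Lemma acommZ x y k : acomm x y -> acomm x (k *: y).
Proof. by rewrite /acomm amulZr amulZl => ->. Qed.

Lemma acommM x y z : acomm x y -> acomm x z -> acomm x (amul y z).
Proof. by rewrite /acomm => xy xz; rewrite amulA xy -amulA xz amulA. Qed.

Lemma acomm_star x y : acomm x y -> acomm (astar x) (astar y).
Proof. by rewrite /acomm -!astarM => ->. Qed.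

Lemma amulBD x y : acomm x y -> amul (x - y) (x + y) = amul x x - amul y y.
Proof.
by rewrite /acomm => xy; rewrite amulBl !amulDr opprD addrA xy addrK.
Qed.

(** Identities between limits are obtained through this criterion, by
    comparing with an approximant up to an arbitrary error. *)
Lemma small_eq0 x : (forall e : R, 0 < e -> nrm x <= e) -> x = 0.
Proof.
move=> xe; apply: nrm_eq0; apply/eqP; rewrite eq_le nrm_ge0 andbT.
by apply/ler_addgt0Pr => e e0; rewrite add0r xe.
Qed.

(** Continuity of left multiplications makes annihilators closed. *)
Lemma cvg_amulr x : continuous (fun y => amul x y).
Proof.
move=> y; apply/cvgrPdist_le => /= e e0.
have [r re r0] := gt0_complexR e0.
have M0 : 0 < nrm x + 1 by rewrite ltr_wpDl // nrm_ge0.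
have d0 : 0 < (r / (nrm x + 1))%:C :> R[i] by rewrite ltcR divr_gt0.
near=> z.
rewrite -amulBr nrmE re lecR; apply: le_trans (nrmM _ _) _.
have : `|y - z| <= (r / (nrm x + 1))%:C.
  by near: z; move/cvgrPdist_le : (@cvg_id _ (nbhs y)) => /(_ _ d0).
rewrite nrmE lecR => h; apply: le_trans (ler_wpM2l (nrm_ge0 _) h) _.
rewrite mulrCA ler_piMr // ?(ltW r0) // ler_pdivrMr // mul1r lerDl ler01.
Unshelve. all: by end_near. Qed.

End cstar_norm.

(** * Square roots by successive approximation *)

Section square_root.
Variables (R : realType) (A : cstarAlgType R).
Implicit Types (x y z c : A).

Let half : R[i] := (2^-1 : R)%:C.

(** If y is a fixed point of this map, then (1 - y) ^ 2 = 1 - x. *)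
Definition sqrt_step x y := half *: (x + amul y y).
Definition sqrt_iter x n := iter n (sqrt_step x) 0.
(** The same iteration for the real number x = 1; it increases to 1. *)
Definition majorant n : R := iter n (fun r => 2^-1 * (1 + r ^+ 2)) 0.

Lemma majorantS n : majorant n.+1 = 2^-1 * (1 + majorant n ^+ 2).
Proof. by []. Qed.

Lemma nrm_half z : nrm (half *: z) = 2^-1 * nrm z.
Proof. by rewrite nrmZ ger0_norm // invr_ge0. Qed.

Lemma scale_half z : half *: (z + z) = z.
Proof.
rewrite scalerDr -scalerDl /half -rmorphD /=.
by rewrite (_ : 2^-1 + 2^-1 = 1 :> R) ?scale1r //; field.
Qed.

Lemma majorant_bounds n : 0 <= majorant n <= 1.
Proof.
elim: n => [|n /andP[r0 r1]] /=; first by rewrite lexx ler01.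
have : majorant n ^+ 2 <= 1 by rewrite expr_le1.
have := sqr_ge0 (majorant n); lra.
Qed.

Lemma nrm_sqrt_iter x n : nrm x <= 1 -> nrm (sqrt_iter x n) <= majorant n.
Proof.
move=> x1; elim: n => [|n IH] /=; first by rewrite nrm0.
rewrite nrm_half ler_pM2l ?invr_gt0 //; apply: le_trans (nrmD _ _) _.
apply: lerD => //; apply: le_trans (nrmM _ _) _.
by rewrite expr2 ler_pM ?nrm_ge0.
Qed.

Lemma acomm_sqrt_iter c x n : acomm c x -> acomm c (sqrt_iter x n).
Proof.
move=> cx; elim: n => [|n IH] /=; first exact: acomm0.
by apply/acommZ/acommD => //; exact: acommM.
Qed.

(** The difference of consecutive squares factors because the iterates
    commute, so the real iteration dominates the one in A term by term. *)
Lemma nrm_sqrt_iterB x n : nrm x <= 1 ->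
  nrm (sqrt_iter x n.+1 - sqrt_iter x n) <= majorant n.+1 - majorant n.
Proof.
move=> x1; elim: n => [|n IH].
  by rewrite /= subr0 /sqrt_step amul0l addr0 nrm_half subr0 expr0n addr0 ler_pM2l ?invr_gt0.
have c : acomm (sqrt_iter x n.+1) (sqrt_iter x n).
  by apply: acomm_sqrt_iter; apply/acomm_sym/acomm_sqrt_iter.
have -> : sqrt_iter x n.+2 - sqrt_iter x n.+1 =
  half *: amul (sqrt_iter x n.+1 - sqrt_iter x n) (sqrt_iter x n.+1 + sqrt_iter x n).
  rewrite amulBD // [in LHS]/sqrt_iter !iterS -!/(sqrt_iter _ _) -scalerBr.
  by congr (_ *: _); rewrite opprD addrACA subrr add0r.
have -> : majorant n.+2 - majorant n.+1 =
  2^-1 * ((majorant n.+1 - majorant n) * (majorant n.+1 + majorant n)).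
  rewrite (majorantS n.+1); have := majorantS n.
  by move: (majorant n.+1) (majorant n) => a b ->; ring.
rewrite nrm_half ler_pM2l ?invr_gt0 //; apply: le_trans (nrmM _ _) _.
apply: ler_pM; rewrite ?nrm_ge0 //; apply: le_trans (nrmD _ _) _.
by apply: lerD; exact: nrm_sqrt_iter.
Qed.

Lemma nrm_sqrt_iter_dist x n m : nrm x <= 1 -> (n <= m)%N ->
  nrm (sqrt_iter x m - sqrt_iter x n) <= majorant m - majorant n.
Proof.
move=> x1 /subnKC <-; elim: (m - n)%N => [|k IH]; first by rewrite addn0 !subrr nrm0.
rewrite addnS -(subrK (sqrt_iter x (n + k)) (sqrt_iter x _.+1)) -addrA.
apply: le_trans (nrmD _ _) _.
by have := nrm_sqrt_iterB (n + k) x1; lra.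
Qed.

Lemma sqrt_iter_cvg x : nrm x <= 1 ->
  exists y, forall e : R, 0 < e -> exists N, forall n, (N <= n)%N ->
    nrm (y - sqrt_iter x n) <= e.
Proof.
move=> x1; pose S := range majorant.
have supS : has_sup S.
  split; first by exists (majorant 0), 0%N.
  by exists 1 => _ [n _ <-]; have /andP[] := majorant_bounds n.
have cau e : 0 < e -> exists N, forall n, (N <= n)%N ->
    nrm (sqrt_iter x n - sqrt_iter x N) < e.
  move=> e0; have [_ [N _ <-] hN] := sup_adherent e0 supS; exists N => n Nn.
  apply: le_lt_trans (nrm_sqrt_iter_dist x1 Nn) _.
  have : majorant n <= sup S by apply: sup_upper_bound => //; exists n.
  by lra.
have : cauchy (sqrt_iter x @ \oo).
  apply/cauchyP => e e0.
  have [r re r0] := gt0_complexR e0.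
  have [N hN] := cau _ r0; exists (sqrt_iter x N); exists N => // n /= Nn.
  by rewrite -ball_normE /= nrmE re ltcR nrm_distC hN.
move/cauchy_cvg => /cvg_ex[y /cvgrPdist_le yl]; exists y => e e0.
have [|N _ hN] := yl e%:C; first by rewrite ltcR.
by exists N => n /hN /=; rewrite nrmE lecR.
Qed.

(** In a unital algebra 1 - y is then a square root of 1 - x. The element y is
    a norm limit of polynomials in x, so it inherits self-adjointness and
    commutation. *)
Lemma exists_sqrt x : nrm x <= 1 ->
  exists y, [/\ nrm y <= 1, y + y = x + amul y y, astar x = x -> astar y = y
    & forall c, acomm c x -> acomm c y].
Proof.
move=> x1; have [y yP] := sqrt_iter_cvg x1; exists y.
have y1 : nrm y <= 1.
  apply/ler_addgt0Pr => e e0; have [N hN] := yP e e0.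
  rewrite -(subrK (sqrt_iter x N) y); apply: le_trans (nrmD _ _) _.
  rewrite addrC lerD ?hN //; apply: le_trans (nrm_sqrt_iter _ x1) _.
  by have /andP[] := majorant_bounds N.
split=> //.
- suff h : y - half *: (x + amul y y) = 0.
    by rewrite -[in RHS](scale_half (x + amul y y)) scalerDr -(subr0_eq h).
  apply: small_eq0 => e e0.
  have [N hN] := yP (e / 2) (divr_gt0 e0 (ltr0Sn _ 1)).
  set z := sqrt_iter x N.
  have -> : y - half *: (x + amul y y) = (y - sqrt_iter x N.+1) +
      half *: (amul (z - y) z + amul y (z - y)).
    rewrite amulBl amulBr addrA subrK.
    have -> : amul z z - amul y y = (x + amul z z) - (x + amul y y).
      by rewrite opprD addrACA subrr add0r.
    by rewrite scalerBr addrA subrK.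
  rewrite (splitr e); apply: le_trans (nrmD _ _) _; apply: lerD; first exact: hN.
  rewrite nrm_half.
  have zy : nrm (z - y) <= e / 2 by rewrite nrm_distC; exact: hN.
  have z1 : nrm z <= 1.
    by apply: le_trans (nrm_sqrt_iter _ x1) _; have /andP[] := majorant_bounds N.
  suff : nrm (amul (z - y) z + amul y (z - y)) <= e / 2 + e / 2 by lra.
  apply: le_trans (nrmD _ _) _; apply: lerD; apply: le_trans (nrmM _ _) _.
    by rewrite -[leRHS]mulr1 ler_pM ?nrm_ge0.
  by rewrite -[leRHS]mul1r ler_pM ?nrm_ge0.
- move=> xs; apply: subr0_eq; apply: small_eq0 => e e0.
  have [N hN] := yP (e / 2) (divr_gt0 e0 (ltr0Sn _ 1)).
  have zs n : astar (sqrt_iter x n) = sqrt_iter x n.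
    elim: n => [|n IH] /=; first exact: astar0.
    by rewrite astarZR astarD astarM IH xs.
  have -> : astar y - y = astar (y - sqrt_iter x N) - (y - sqrt_iter x N).
    by rewrite astarB zs opprB addrA subrK.
  apply: le_trans (nrmB _ _) _; rewrite nrm_star (splitr e).
  by apply: lerD; exact: hN.
- move=> c cx; rewrite /acomm; apply: subr0_eq; apply: small_eq0 => e e0.
  have M0 : 0 < nrm c + nrm c + 1 by rewrite ltr_wpDl // addr_ge0 // nrm_ge0.
  have [N hN] := yP (e / (nrm c + nrm c + 1)) (divr_gt0 e0 M0).
  have {}hN := hN N (leqnn N).
  have -> : amul c y - amul y c =
      amul c (y - sqrt_iter x N) - amul (y - sqrt_iter x N) c.
    rewrite amulBr amulBl (acomm_sqrt_iter N cx) opprB addrA subrK //.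
  apply: le_trans (nrmB _ _) _.
  apply: le_trans (lerD (nrmM _ _) (nrmM _ _)) _.
  rewrite [X in _ + X]mulrC -mulrDl.
  apply: le_trans (ler_wpM2l _ hN) _; first by rewrite addr_ge0 ?nrm_ge0.
  rewrite mulrCA ler_piMr ?(ltW e0) // ler_pdivrMr // mul1r lerDl ler01 //.
Qed.

End square_root.

(** * Positivity without spectral theory *)

Section commuting_squares.
Variables (R : realType) (A : cstarAlgType R).
Implicit Types (x y z p q : A).

Lemma add_self x : x + x = (2 : R)%:C *: x.
Proof. by rewrite rmorphD scalerDl scale1r. Qed.

Lemma amul_addi_subi p q : acomm p q ->
  amul (p - 'i *: q) (p + 'i *: q) = amul p p + amul q q.
Proof.
move=> pq; rewrite amulBD; last exact: acommZ.
rewrite amulZl amulZr scalerA (_ : 'i * 'i = -1 :> R[i]) ?scaleN1r ?opprK //.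
by rewrite -expr2 sqr_i.
Qed.

(** The positive elements p ^ 2 and q ^ 2 satisfy this monotonicity because p
    is the real part of t = p + i q, while t* t = p ^ 2 + q ^ 2. *)
Lemma nrm_sqr_le p q : astar p = p -> astar q = q -> acomm p q ->
  nrm (amul p p) <= nrm (amul p p + amul q q).
Proof.
move=> ps qs pq; rewrite -amul_addi_subi //.
set t := p + 'i *: q.
have ts : p - 'i *: q = astar t by rewrite astarD astarZi ps qs.
rewrite ts nrm_cstar; apply: le_trans (nrmM _ _) _; rewrite -expr2.
rewrite lerXn2r // ?nnegrE ?nrm_ge0 //.
have : nrm (p + p) <= nrm t + nrm t.
  rewrite -{2}(nrm_star t) -ts; apply: le_trans (nrmD _ _).
  by rewrite addrACA subrr addr0.
by rewrite add_self nrmZ ger0_norm // mulr_natl mulr2n; lra.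
Qed.

End commuting_squares.

Section unital.
Variables (R : realType) (A : cstarAlgType R) (e : A).
Hypotheses (mul1x : forall x, amul e x = x) (mulx1 : forall x, amul x e = x).
Implicit Types (x y z w p q : A).

Let acomm1 x : acomm x e.
Proof. by rewrite /acomm mul1x mulx1. Qed.

Lemma unit_star : astar e = e.
Proof. by rewrite -[RHS]astarK -[astar e in RHS]mulx1 astarM astarK mulx1. Qed.

Lemma unit_nrm_sqr : nrm e = nrm e ^+ 2.
Proof. by rewrite -nrm_cstar unit_star mul1x. Qed.

Lemma nrm_unit_le1 : nrm e <= 1.
Proof.
have [e0|e0] := eqVneq (nrm e) 0; first by rewrite e0 ler01.
by have /eqP := unit_nrm_sqr; rewrite expr2 -{1}[nrm e]mulr1 (inj_eq (mulfI e0)) => /eqP <-.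
Qed.

Lemma nrm_unit : e != 0 -> nrm e = 1.
Proof.
move=> e0; have {}e0 : nrm e != 0 by apply: contra_neq e0; exact: nrm_eq0.
by have /eqP := unit_nrm_sqr; rewrite expr2 -{1}[nrm e]mulr1 (inj_eq (mulfI e0)) => /eqP <-.
Qed.

Lemma unit_sqrt x : nrm x <= 1 -> exists s, [/\ nrm (e - s) <= 1,
  amul s s = e - x, astar x = x -> astar s = s
  & forall c, acomm c x -> acomm c s].
Proof.
move=> /exists_sqrt[y [y1 yE ys yc]]; exists (e - y); split.
- by rewrite opprB addrCA subrr addr0.
- have yy : amul y y - y = y - x.
    by apply/eqP; rewrite subr_eq addrAC yE addrAC subrr add0r.
  by rewrite amulBl !amulBr !mul1x mulx1 opprB yy addrA subrK.
- by move=> /ys ys'; rewrite astarB unit_star ys'.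
- by move=> c /yc; exact: acommB.
Qed.

(** With s ^ 2 = e - w ^ 2, this is monotonicity for the sum s ^ 2 + w ^ 2 =
    e. *)
Lemma nrm_unitB_sqr w : astar w = w -> nrm w <= 1 -> nrm (e - amul w w) <= 1.
Proof.
move=> ws w1.
have w21 : nrm (amul w w) <= 1.
  by apply: le_trans (nrmM _ _) _; rewrite -[leRHS]mulr1 ler_pM ?nrm_ge0.
have [s [_ sE ss sc]] := unit_sqrt w21.
rewrite -sE; apply: le_trans (nrm_sqr_le (q := w) _ _ _) _ => //.
- by apply: ss; rewrite astarM ws.
- by apply/acomm_sym/sc; apply: acommM.
- by rewrite sE subrK nrm_unit_le1.
Qed.


Lemma nrm_double_le x (r : R) : nrm (x + x) <= r + r -> nrm x <= r.
Proof. by rewrite add_self nrmZ ger0_norm // mulr_natl mulr2n; lra. Qed.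

(** The square of e + m v exceeds e + 2 m v by the square of m v, and e + 2 m
    v is itself a square: up to the factor 1 + 2 m it has the form e - x with
    x in the unit ball. *)
Lemma nrm_double_step v (m : R) : astar v = v -> nrm (e - v) <= 1 -> 0 <= m ->
  nrm (e + m%:C *: v) <= 1 -> nrm (e + (m + m)%:C *: v) <= 1.
Proof.
move=> vs v1 m0 h.
have k0 : 0 < 1 + (m + m) by lra.
(* x is chosen so that (1 + 2 m) (e - x) = e + 2 m v. *)
pose x := ((m + m) / (1 + (m + m)))%:C *: (e - v).
have x1 : nrm x <= 1.
  rewrite nrmZ ger0_norm; last by rewrite divr_ge0 //; lra.
  rewrite -[leRHS]mulr1 ler_pM ?nrm_ge0 //; first by rewrite divr_ge0 //; lra.
  by rewrite ler_pdivrMr // mul1r; lra.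
have [s [_ sE ss sc]] := unit_sqrt x1.
have {}ss : astar s = s by apply: ss; rewrite astarZR astarB unit_star vs.
have vs_comm : acomm v s by apply: sc; apply/acommZ/acommB.
pose p := (Num.sqrt (1 + (m + m)))%:C *: s.
have pE : amul p p = e + (m + m)%:C *: v.
  rewrite amulZl amulZr scalerA -rmorphM /= -expr2 sqr_sqrtr ?(ltW k0) // sE.
  rewrite scalerBr scalerA -rmorphM /= mulrCA divff ?gt_eqF // mulr1.
  by rewrite scalerBr opprB addrCA addrC rmorphD scalerDl scale1r addrK.
have -> : e + (m + m)%:C *: v = amul p p by [].
apply: le_trans (nrm_sqr_le (q := m%:C *: v) _ _ _) _.
- by rewrite astarZR ss.
- by rewrite astarZR vs.
- by apply/acommZ/acomm_sym/acommZ.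
- have -> : amul p p + amul (m%:C *: v) (m%:C *: v) =
            amul (e + m%:C *: v) (e + m%:C *: v).
    rewrite pE rmorphD scalerDl amulDl !amulDr !mul1x mulx1.
    by rewrite -!addrA.
  by apply: le_trans (nrmM _ _) _; rewrite -[leRHS]mulr1 ler_pM ?nrm_ge0.
Qed.

(** Averaging the squares of e - w and e + w puts e + w ^ 2 in the unit ball;
    by doubling, e + 2 ^ n w ^ 2 lies there for all n, which forces w ^ 2 = 0. *)
Lemma unit_extreme w : astar w = w -> nrm (e - w) <= 1 -> nrm (e + w) <= 1 ->
  w = 0.
Proof.
move=> ws wB wD.
have w1 : nrm w <= 1.
  apply: nrm_double_le; have -> : w + w = (e + w) - (e - w).
    by rewrite opprB [w - e]addrC addrACA subrr add0r.
  by apply: le_trans (nrmB _ _) _; exact: lerD.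
pose v := amul w w.
have vs : astar v = v by rewrite astarM ws.
have v1 : nrm (e - v) <= 1 by exact: nrm_unitB_sqr.
have vD : nrm (e + v) <= 1.
  apply: nrm_double_le.
  have -> : e + v + (e + v) = amul (e + w) (e + w) + amul (e - w) (e - w).
    rewrite amulBl amulDl !amulBr !amulDr !mul1x !mulx1 opprB -/v.
    by rewrite [v - w]addrC [RHS]addrACA [e + w + _]addrACA [w + v + _]addrACA
      !subrr addr0 add0r addrACA.
  apply: le_trans (nrmD _ _) _; apply: lerD; apply: le_trans (nrmM _ _) _;
  by rewrite -[leRHS]mulr1 ler_pM ?nrm_ge0.
have pow n : nrm (e + (2 ^+ n : R)%:C *: v) <= 1.
  elim: n => [|n IH]; first by rewrite expr0 scale1r.
  have -> : 2 ^+ n.+1 = 2 ^+ n + 2 ^+ n :> R by rewrite exprS mulr_natl mulr2n.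
  by apply: nrm_double_step => //; rewrite exprn_ge0.
have v0 : nrm v <= 0.
  apply/ler_addgt0Pr => d d0; rewrite add0r.
  have [n nP] : exists n, 2 / d < 2 ^+ n.
    exists (Num.truncn (2 / d)).+1; apply: lt_trans (truncnS_gt _) _.
    by rewrite -natrX ltr_nat ltn_expl.
  have : nrm ((2 ^+ n : R)%:C *: v) <= 2.
    rewrite -(addrK e (_ *: v)) [_ + e]addrC; apply: le_trans (nrmB _ _) _.
    by have := pow n; have := nrm_unit_le1; lra.
  rewrite nrmZ ger0_norm ?exprn_ge0 // => h.
  have p0 : 0 < 2 ^+ n :> R by rewrite exprn_gt0.
  move: nP; rewrite ltr_pdivrMr // => nP.
  by rewrite -(ler_pM2l p0); apply: le_trans h (ltW _).
apply: nrm_eq0; apply/eqP; rewrite -sqrf_eq0 -nrm_cstar ws.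
by rewrite eq_le v0 nrm_ge0.
Qed.

Lemma nrm_line_continuous z : continuous (fun t : R => nrm (t%:C *: e + z)).
Proof.
move=> t; apply/cvgrPdist_le => d d0; near=> u.
have tri x y : nrm x - nrm y <= nrm (x - y).
  by rewrite lerBlDr; apply: le_trans (nrmD _ _); rewrite subrK.
have le a b : nrm (a%:C *: e + z) - nrm (b%:C *: e + z) <= `|a - b|.
  apply: le_trans (tri _ _) _; rewrite opprD addrACA subrr addr0 -scalerBl.
  rewrite -rmorphB nrmZ -[leRHS]mulr1 ler_wpM2l //; exact: nrm_unit_le1.
have h : `|t - u| <= d by near: u; exact: cvgr_dist_le.
rewrite ler_norml; apply/andP; split; last exact: le_trans (le _ _) h.
by rewrite lerNl opprB; apply: le_trans (le _ _) _; rewrite distrC.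
Unshelve. all: by end_near. Qed.

End unital.

(** * Central elements of a prime C*-algebra *)

Section prime_centre.
Variables (R : realType) (A : cstarAlgType R).
Hypothesis hprime : prime_cstar A.
Implicit Types (x y z w c : A).

Lemma closed_rannihilator z : closed [set x | amul z x = 0].
Proof.
rewrite (_ : [set x | amul z x = 0] = amul z @^-1` [set 0]) //.
apply: closed_comp; first by move=> x _; exact: cvg_amulr.
by apply: accessible_closed_set1; exact/hausdorff_accessible/norm_hausdorff.
Qed.

(** The annihilator I of z1 and the annihilator J of I are ideals with zero
    intersection, and they contain z2 and z1 respectively. *)
Lemma prime_central_mul_eq0 z1 z2 : astar z1 = z1 -> (forall c, acomm c z1) ->
  amul z1 z2 = 0 -> z1 = 0 \/ z2 = 0.
Proof.
move=> z1s z1c z12.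
pose I := [set x | amul z1 x = 0]; pose J := [set x | forall y, I y -> amul y x = 0].
have idI : closed_ideal I.
  split; first exact: closed_rannihilator.
  - exact: amul0r.
  - by move=> x y; rewrite /I /= amulDr => -> ->; rewrite addr0.
  - by move=> k x; rewrite /I /= amulZr => ->; rewrite scaler0.
  - move=> a x; rewrite /I /= => zx; split; last by rewrite amulA zx amul0l.
    by rewrite amulA -(z1c a) -amulA zx amul0r.
have idJ : closed_ideal J.
  split.
  - rewrite (_ : J = \bigcap_(y in I) [set x | amul y x = 0]).
      by apply: closed_bigI => y _; exact: closed_rannihilator.
    by apply/seteqP; split=> x Jx y /Jx.
  - by move=> y _; exact: amul0r.
  - by move=> x y Jx Jy u Iu; rewrite amulDr Jx // Jy // addr0.
  - by move=> k x Jx u Iu; rewrite amulZr Jx // scaler0.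
  - move=> a x Jx; split=> u Iu; last by rewrite amulA Jx // amul0l.
    by rewrite amulA Jx //; case: idI => _ _ _ _ /(_ a u Iu)[].
have [->|z10] := eqVneq z1 0; first by left.
have [->|z20] := eqVneq z2 0; first by right.
have I0 : I <> [set 0].
  by move=> I0; have : I z2 by []; rewrite I0 => /eqP; rewrite (negbTE z20).
have J0 : J <> [set 0].
  move=> J0; have : J z1 by move=> y; rewrite /I /= -(z1c y).
  by rewrite J0 => /eqP; rewrite (negbTE z10).
exfalso; apply: (hprime idI idJ I0 J0); apply/seteqP; split=> [x [Ix Jx]|_ ->]; last first.
  by case: idI idJ => _ I00 _ _ _ [_ J00 _ _ _].
(* The adjoint of x also lies in I, hence x* x = 0. *)
apply: nrm_eq0; apply/eqP; rewrite -sqrf_eq0 -nrm_cstar Jx ?nrm0 //.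
by rewrite /I /= -z1s -astarM (z1c x) Ix astar0.
Qed.

Variable e : A.
Hypotheses (mul1x : forall x, amul e x = x) (mulx1 : forall x, amul x e = x).

Let acomm1 x : acomm x e.
Proof. by rewrite /acomm mul1x mulx1. Qed.

(** A weak form of the dichotomy between w >= 0 and w <= 0: w differs from its
    absolute value s at most by a sign, since (s - w)(s + w) = 0. *)
Lemma prime_central_sign w : astar w = w -> (forall c, acomm c w) ->
  nrm w <= 1 -> nrm (e - w) <= 1 \/ nrm (e + w) <= 1.
Proof.
move=> ws wc w1.
have w21 := nrm_unitB_sqr mul1x mulx1 ws w1.
have [s [s1 sE ss sc]] := unit_sqrt mul1x mulx1 w21.
have {}ss : astar s = s.
  by apply: ss; rewrite astarB (unit_star mulx1) astarM ws.
have {}sc c : acomm c s by apply/sc/acommB => //; exact: acommM.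
have sw : amul (s - w) (s + w) = 0.
  by rewrite amulBD // sE subKr subrr.
have [| |s0|s0] := prime_central_mul_eq0 _ _ sw.
- by rewrite astarB ss ws.
- by move=> c; exact: acommB.
- by left; rewrite -(subr0_eq s0).
- by right; rewrite -[w]opprK -(addr0_eq s0) opprK.
Qed.

(** For w = z - t e the norms of e - w and e + w depend continuously on t, and
    their difference changes sign on the interval from - 1/2 to 1/2. *)
Lemma prime_central_scalar_half z : e != 0 -> astar z = z ->
  (forall c, acomm c z) -> nrm z <= 2^-1 -> exists t : R, z = t%:C *: e.
Proof.
move=> e0 zs zc z1.
have e1 := nrm_unit mul1x mulx1 e0.
have nrme (t : R) : nrm (t%:C *: e) = `|t| by rewrite nrmZ e1 mulr1.
pose f t := nrm (t%:C *: e + (e - z)) - nrm ((- t)%:C *: e + (e + z)).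
have fc : continuous f.
  move=> t; apply: cvgB; first exact: (nrm_line_continuous mul1x mulx1).
  apply: (@continuous_comp _ _ _ (fun t => - t) (fun t : R => nrm (t%:C *: e + (e + z)))).
    exact: opp_continuous.
  exact: (nrm_line_continuous mul1x mulx1).
have tri x y : nrm x <= nrm (x + y) + nrm y.
  by rewrite -{1}(addrK y x) nrmB.
have hs (b : R) : (2^-1)%:C *: e + b%:C *: e = (2^-1 + b)%:C *: e.
  by rewrite rmorphD scalerDl.
have eE (t : R) : t%:C *: e + e = (t + 1)%:C *: e.
  by rewrite rmorphD scalerDl scale1r.
have [|||t] := @IVT R f (- 2^-1) 2^-1 0; first by lra.
- by apply: continuous_subspaceT.
- have fl : f (- 2^-1) <= 0.
    rewrite /f opprK !addrA !eE.
    have h1 := nrmB ((- 2^-1 + 1)%:C *: e) z.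
    have h2 := tri ((2^-1 + 1)%:C *: e) z.
    by rewrite !nrme !ger0_norm in h1 h2; lra.
  have fr : 0 <= f (2^-1).
    rewrite /f !addrA !eE.
    have h1 := nrmD ((- 2^-1 + 1)%:C *: e) z.
    have h2 := tri ((2^-1 + 1)%:C *: e) (- z).
    by rewrite nrmN !nrme !ger0_norm in h1 h2; lra.
  by rewrite ge_min fl le_max fr orbT.
rewrite in_itv /= => /andP[tl tr] /eqP; rewrite /f subr_eq0 => /eqP ft.
pose w := z - t%:C *: e.
have wB : nrm (e - w) = nrm (t%:C *: e + (e - z)).
  by rewrite opprB addrCA.
have wD : nrm (e + w) = nrm ((- t)%:C *: e + (e + z)).
  by rewrite rmorphN scaleNr addrA addrC.
have ws : astar w = w by rewrite astarB zs astarZR (unit_star mulx1).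
have wc c : acomm c w by apply: acommB => //; exact: acommZ.
have w1 : nrm w <= 1.
  apply: le_trans (nrmB _ _) _; rewrite nrme.
  by have : `|t| <= 2^-1 by [rewrite ler_norml tl tr]; lra.
have [h1 h2] : nrm (e - w) <= 1 /\ nrm (e + w) <= 1.
  by have [] := prime_central_sign ws wc w1; rewrite wB wD ft.
by exists t; apply: subr0_eq; exact: (unit_extreme mul1x mulx1 ws h1 h2).
Qed.

Lemma prime_central_scalar z : e != 0 -> astar z = z ->
  (forall c, acomm c z) -> exists t : R, z = t%:C *: e.
Proof.
move=> e0 zs zc; pose m := (2 * (nrm z + 1))^-1.
have m0 : 0 < m by rewrite invr_gt0; have := nrm_ge0 z; lra.
have [|||t zt] := @prime_central_scalar_half (m%:C *: z) e0.
- by rewrite astarZR zs.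
- by move=> c; exact: acommZ.
- rewrite nrmZ gtr0_norm // /m invfM -mulrA ler_piMr ?invr_ge0 // mulrC.
  rewrite ler_pdivrMr; first by rewrite mul1r lerDl.
  by have := nrm_ge0 z; lra.
exists (m^-1 * t); rewrite rmorphM -scalerA -zt scalerA -rmorphM /=.
by rewrite mulVf ?gt_eqF // scale1r.
Qed.

End prime_centre.

(** * Rigid subsets and their commutants *)

Section rigidity.
Variables (R : realType) (A : cstarAlgType R) (S : set A).
Hypothesis rigid : forall phi : A -> A, star_hom phi ->
  (forall x, S x -> phi x = x) -> forall x, phi x = x.
Implicit Types (x y z w c u : A).

Section reflection.
Variable e : A.
Hypotheses (es : astar e = e) (ee : amul e e = e).

Let lft x := x - (amul e x + amul e x).
Let rgt x := x - (amul x e + amul x e).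

Let lftK x : lft (lft x) = x.
Proof.
have ex : amul e (lft x) = - amul e x.
  by rewrite amulBr amulDr amulA ee opprD addrA subrr sub0r.
by rewrite {1}/lft ex -opprD opprK subrK.
Qed.

Let lftM x y : lft (amul x y) = amul (lft x) y.
Proof. by rewrite /lft amulBl amulDl !amulA. Qed.

Let rgtM x y : rgt (amul x y) = amul x (rgt y).
Proof. by rewrite /rgt amulBr amulDr !amulA. Qed.

Let rgt_lft x y : amul (rgt x) y = amul x (lft y).
Proof. by rewrite /rgt /lft amulBl amulDl amulBr amulDr !amulA. Qed.

Let lft_linear : linear lft.
Proof.
move=> k x y; rewrite /lft amulDr amulZr scalerBr scalerDr.
by rewrite [k *: amul e x + _ + _]addrACA opprD addrACA.
Qed.

Let rgt_linear : linear rgt.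
Proof.
move=> k x y; rewrite /rgt amulDl amulZl scalerBr scalerDr.
by rewrite [k *: amul x e + _ + _]addrACA opprD addrACA.
Qed.

Let lft_rgt x : lft (rgt x) = rgt (lft x).
Proof.
have rgtD y z : rgt (y + z) = rgt y + rgt z.
  by have := rgt_linear 1 y z; rewrite !scale1r.
have rgtN y : rgt (- y) = - rgt y.
  by rewrite /rgt amulNl -!opprD.
by rewrite [in RHS]/lft rgtD rgtN rgtD rgtM.
Qed.

Let star_lft x : astar (lft x) = rgt (astar x).
Proof. by rewrite /lft /rgt astarB astarD astarM es. Qed.

Let star_rgt x : astar (rgt x) = lft (astar x).
Proof. by rewrite /lft /rgt astarB astarD astarM es. Qed.

(** The composite of left and right multiplication by 1 - 2 e is a star
    homomorphism because 1 - 2 e is a self-adjoint involution; writing it out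
    avoids adjoining a unit. *)
Lemma reflection_star_hom : star_hom (fun x => lft (rgt x)).
Proof.
split.
- by move=> k x y; rewrite rgt_linear lft_linear.
- by move=> x y; rewrite rgtM lftM -[RHS]lftM rgt_lft lftK lftM.
- by move=> x; rewrite star_lft star_rgt lft_rgt.
Qed.

(** Invariance under the reflection makes e central; then x |-> e x is a star
    homomorphism fixing S. *)
Lemma rigid_unit : (forall x, S x -> amul e x = x /\ amul x e = x) ->
  (forall x, amul e x = x) /\ (forall x, amul x e = x).
Proof.
move=> eS.
have id x : lft (rgt x) = x.
  apply: (rigid reflection_star_hom) => {}x /eS[ex xe].
  by rewrite /rgt xe opprD addrA subrr sub0r /lft amulNr ex opprD opprK addrA addNr add0r.
have ec x : amul e x = amul x e.
  have : lft x = rgt x by rewrite -[in LHS](id x) lftK.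
  by move=> /addrI/oppr_inj; rewrite !add_self => /scalerI; apply; exact: two_neq0.
have ex x : amul e x = x.
  apply: (rigid (phi := amul e)) => [|{}x /eS[] //]; split.
  - by move=> k y z; rewrite amulDr amulZr.
  - move=> y z; rewrite -[RHS]amulA [amul y (amul e z)]amulA -ec.
    by rewrite -[amul (amul e y) z]amulA [RHS]amulA ee.
  - by move=> y; rewrite astarM es ec.
by split=> // x; rewrite -ec.
Qed.

End reflection.

Section unit.
Variable e : A.
Hypotheses (mul1x : forall x, amul e x = x) (mulx1 : forall x, amul x e = x).

Lemma rigid_inner u : amul (astar u) u = e -> amul u (astar u) = e ->
  (forall x, S x -> acomm x u) -> forall x, acomm x u.
Proof.
move=> usu uus uS x.
have phiE : amul (amul u x) (astar u) = x.
  apply: (rigid (phi := fun x => amul (amul u x) (astar u))) => [|{}x Sx]; last first.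
    by rewrite -(uS x Sx) -amulA uus mulx1.
  split.
  - by move=> k y z; rewrite amulDr amulDl amulZr amulZl.
  - move=> y z; rewrite -!amulA; congr (amul u (amul y _)).
    by rewrite amulA usu mul1x.
  - by move=> y; rewrite !astarM astarK amulA.
by rewrite /acomm -{1}phiE -amulA usu mulx1.
Qed.

(** The element w is the imaginary part of the unitary sqrt (e - w ^ 2) + i w,
    to which rigid_inner applies. *)
Lemma rigid_central w : astar w = w -> nrm w <= 1 ->
  (forall x, S x -> acomm x w) -> forall x, acomm x w.
Proof.
move=> ws w1 wS.
have w21 : nrm (amul w w) <= 1.
  by apply: le_trans (nrmM _ _) _; rewrite -[leRHS]mulr1 ler_pM ?nrm_ge0.
have [s [_ sE ss sc]] := unit_sqrt mul1x mulx1 w21.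
have {}ss : astar s = s by apply: ss; rewrite astarM ws.
have sw : acomm s w by apply/acomm_sym/sc; exact: acommM.
pose u := s + 'i *: w.
have us : astar u = s - 'i *: w by rewrite astarD astarZi ws ss.
have unit2 : amul s s + amul w w = e by rewrite sE subrK.
have uc : forall x, acomm x u.
  apply: rigid_inner.
  - by rewrite us amul_addi_subi.
  - rewrite us -[in LHS](opprK ('i *: w)) -scalerN opprK -unit2.
    have := amul_addi_subi (acommN sw).
    by rewrite scalerN opprK amulNl amulNr opprK.
  - by move=> x Sx; apply: acommD; [apply: sc; apply: acommM|apply: acommZ]; exact: wS.
have usc x : acomm x (astar u).
  by rewrite -(astarK x); apply: acomm_star.
move=> x; have := acommB (uc x) (usc x).
rewrite us /u opprB ['i *: w - s]addrC addrACA subrr add0r -scalerDr add_self scalerA => h.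
have k0 : 'i * (2 : R)%:C != 0 :> R[i].
  by rewrite mulf_neq0 ?neq0Ci ?two_neq0.
by have := acommZ ('i * (2 : R)%:C)^-1 h; rewrite scalerA mulVf // scale1r.
Qed.

(** Real and imaginary parts reduce the claim to self-adjoint elements, and
    rescaling to contractions. *)
Lemma prime_rigid_scalar z : prime_cstar A -> e != 0 ->
  (forall x, S x -> S (astar x)) -> (forall x, S x -> acomm x z) ->
  exists k : R[i], z = k *: e.
Proof.
move=> hprime e0 Sstar zS.
have sa w : astar w = w -> (forall x, S x -> acomm x w) ->
    exists t : R, w = t%:C *: e.
  move=> ws wS; apply: (prime_central_scalar hprime mul1x mulx1) => //.
  pose m := (nrm w + 1)^-1.
  have m0 : 0 < m by rewrite invr_gt0 ltr_wpDl // nrm_ge0.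
  have wmc : forall c, acomm c (m%:C *: w).
    apply: rigid_central; first by rewrite astarZR ws.
      rewrite nrmZ gtr0_norm // mulrC ler_pdivrMr ?mul1r ?lerDl //.
      by rewrite ltr_wpDl // nrm_ge0.
    by move=> x Sx; apply/acommZ/wS.
  move=> c; have := acommZ (m^-1)%:C (wmc c).
  by rewrite scalerA -rmorphM /= mulVf ?gt_eqF // scale1r.
have zsS x : S x -> acomm x (astar z).
  by move=> Sx; rewrite -(astarK x); apply/acomm_star/zS/Sstar.
have [||a az] := sa (z + astar z).
- by rewrite astarD astarK addrC.
- by move=> x Sx; apply: acommD; [exact: zS|exact: zsS].
have [||b bz] := sa ('i *: (z - astar z)).
- by rewrite astarZi astarB astarK -scalerN opprB.
- by move=> x Sx; apply/acommZ/acommB; [exact: zS|exact: zsS].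
exists ((2 : R)%:C^-1 * (a%:C - 'i * b%:C)).
rewrite -scalerA scalerBl -scalerA -az -bz scalerA -expr2 sqr_i scaleN1r opprK.
rewrite addrACA subrr addr0 add_self scalerA mulVf ?scale1r //.
exact: two_neq0.
Qed.

End unit.
End rigidity.

(** * Unconditional sums of complex families *)

Section complex_modulus.
Variable R : realType.
Implicit Types (u v : R[i]).

Definition nc u : R := Normc.normc u.

Lemma nc_ge0 u : 0 <= nc u.
Proof. by case: u => a b; exact: sqrtr_ge0. Qed.

Lemma ncD u v : nc (u + v) <= nc u + nc v.
Proof. exact: le_normcD. Qed.

Lemma ncM u v : nc (u * v) = nc u * nc v.
Proof. exact: Normc.normcM. Qed.

Lemma ncJ u : nc (conjc u) = nc u.
Proof. by case: u => a b; rewrite /nc /= sqrrN. Qed.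

Lemma nc0 : nc 0 = 0.
Proof. exact: Normc.normc0. Qed.

Lemma ncN u : nc (- u) = nc u.
Proof. exact: normcN. Qed.

Lemma ncB u v : nc (u - v) <= nc u + nc v.
Proof. by rewrite -(ncN v) ncD. Qed.

Lemma nc_eq0 u : nc u = 0 -> u = 0.
Proof. exact: Normc.eq0_normc. Qed.

Lemma nc_real (r : R) : 0 <= r -> nc r%:C = r.
Proof. by move=> r0; rewrite /nc /= expr0n addr0 sqrtr_sqr ger0_norm. Qed.

Lemma ncE u : `|u| = (nc u)%:C.
Proof. by rewrite normc_def; case: u. Qed.

Lemma nc_sqr u : (nc u ^+ 2)%:C = conjc u * u.
Proof. by rewrite rmorphXn /= -ncE sqr_normc mulrC. Qed.

Lemma nc_Re u : `|complex.Re u| <= nc u.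
Proof. by case: u => a b; rewrite /nc /= -sqrtr_sqr ler_wsqrtr // lerDl sqr_ge0. Qed.

Lemma nc_Im u : `|complex.Im u| <= nc u.
Proof. by case: u => a b; rewrite /nc /= -sqrtr_sqr ler_wsqrtr // lerDr sqr_ge0. Qed.

Lemma nc_le_ReIm u : nc u <= `|complex.Re u| + `|complex.Im u|.
Proof.
case: u => a b; rewrite /nc /=.
rewrite -[leRHS]ger0_norm ?addr_ge0 // -sqrtr_sqr ler_wsqrtr //.
by rewrite sqrrD !real_normK ?num_real // lerD2r lerDl mulrn_wge0 ?mulr_ge0.
Qed.

Lemma nc_sum (I : Type) (s : seq I) (f : I -> R[i]) :
  nc (\sum_(i <- s) f i) <= \sum_(i <- s) nc (f i).
Proof.
elim: s => [|i s IH]; first by rewrite !big_nil nc0.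
by rewrite !big_cons; apply: le_trans (ncD _ _) _; rewrite lerD2l.
Qed.

Lemma nc_small u : (forall e : R, 0 < e -> nc u <= e) -> u = 0.
Proof.
move=> ue; apply: nc_eq0; apply/eqP; rewrite eq_le nc_ge0 andbT.
by apply/ler_addgt0Pr => e e0; rewrite add0r ue.
Qed.

Lemma Re_sum (I : Type) (s : seq I) (f : I -> R[i]) :
  complex.Re (\sum_(i <- s) f i) = \sum_(i <- s) complex.Re (f i).
Proof. by elim/big_rec2: _ => // i x [a b] _ <-; case: (f i). Qed.

Lemma Im_sum (I : Type) (s : seq I) (f : I -> R[i]) :
  complex.Im (\sum_(i <- s) f i) = \sum_(i <- s) complex.Im (f i).
Proof. by elim/big_rec2: _ => // i x [a b] _ <-; case: (f i). Qed.

End complex_modulus.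

Section absolute_sums.
Variables (R : realType) (T : choiceType).
Implicit Types (u v : T -> R[i]) (f : T -> R) (A B : {fset T}).

Lemma ler_fset_sum f A B : (forall i, 0 <= f i) -> (A `<=` B)%fset ->
  \sum_(i <- A) f i <= \sum_(i <- B) f i.
Proof.
move=> f0 AB; rewrite [leRHS](big_fsetID _ (mem A)) /=.
have -> : [fset x | x in B & x \in A]%fset = A.
  by apply/fsetP => x; rewrite !inE andbC; case: (boolP (x \in A)) => // /(fsubsetP AB).
by rewrite lerDl sumr_ge0.
Qed.

Lemma esum_fset_approx f (M : R) : (forall i, 0 <= f i) ->
  (forall A, \sum_(i <- A) f i <= M) ->
  [/\ (\esum_(i in [set: T]) (f i)%:E <= M%:E)%E,
      forall A, \sum_(i <- A) f i <= fine (\esum_(i in [set: T]) (f i)%:E)%E &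
      forall e : R, 0 < e -> exists A,
        fine (\esum_(i in [set: T]) (f i)%:E)%E - e < \sum_(i <- A) f i].
Proof.
move=> f0 fM; set S := (\esum_(i in _) _)%E.
have SM : (S <= M%:E)%E.
  apply: ge_ereal_sup => _ [A [finA _] <-].
  by rewrite fsbig_finite //= sumEFin lee_fin.
have S0 : (0 <= S)%E by apply: esum_ge0 => i _; rewrite lee_fin.
have SE : S = (fine S)%:E.
  by rewrite fineK // ge0_fin_numE //; apply: le_lt_trans SM (ltry _).
split=> // [A|e e0].
  rewrite -lee_fin -SE -sumEFin; apply: ereal_sup_ubound; exists [set` A]; first by split.
  by rewrite fsbig_finite // set_fsetK.
have /ereal_sup_gt[_ [A [finA _] <-]] : ((fine S - e)%:E < S)%E.
  by rewrite {2}SE lte_fin ltrBlDr ltrDl.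
by rewrite fsbig_finite //= sumEFin lte_fin => h; exists (fset_set A).
Qed.

(** If a finite sum is within e of the supremum, then disjoint finite sums are
    at most e. *)
Lemma fset_sum_tail f (M : R) : (forall i, 0 <= f i) ->
  (forall A, \sum_(i <- A) f i <= M) -> forall e : R, 0 < e ->
  exists A, forall B, (forall i, i \in B -> i \notin A) -> \sum_(i <- B) f i <= e.
Proof.
move=> f0 fM e e0; have [_ h1 h2] := esum_fset_approx f0 fM.
have [A hA] := h2 e e0; exists A => B BA.
have := h1 (A `|` B)%fset.
rewrite (big_fsetID _ (mem A)) /=.
have -> : [fset x | x in (A `|` B)%fset & x \in A]%fset = A.
  by apply/fsetP => x; rewrite !inE; case: (x \in A); rewrite ?andbF.
have -> : [fset x | x in (A `|` B)%fset & x \notin A]%fset = B.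
  apply/fsetP => x; rewrite !inE; case: (boolP (x \in A)) => [xA|_]; rewrite ?andbF ?andbT //.
  by apply/esym/negP => /BA; rewrite xA.
by move: hA; lra.
Qed.

(** Absolute summability with an explicit bound, expressed by finite sums
    only. *)
Definition abs_le u (M : R) := forall A, \sum_(i <- A) nc (u i) <= M.

Lemma abs_le_ge0 u M : abs_le u M -> 0 <= M.
Proof. by move=> /(_ fset0); rewrite big_seq_fset0. Qed.

Lemma in_ell1_abs_le u : (ell1_norm u < +oo)%E -> abs_le u (fine (ell1_norm u)).
Proof.
move=> u1 A; have SE : ell1_norm u = (fine (ell1_norm u))%:E.
  by rewrite fineK // ge0_fin_numE // norm1_ge0.
rewrite -lee_fin -SE -sumEFin; apply: ereal_sup_ubound; exists [set` A]; first by split.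
by rewrite fsbig_finite // set_fsetK.
Qed.

Lemma abs_le_in_ell1 u M : abs_le u M -> (ell1_norm u < +oo)%E.
Proof.
move=> uM; apply: (@le_lt_trans _ _ M%:E); last exact: ltry.
by have [] := esum_fset_approx (fun i => nc_ge0 (u i)) uM.
Qed.

Lemma rsum_approx (w : T -> R) (M : R) : (forall A, \sum_(i <- A) `|w i| <= M) ->
  forall e : R, 0 < e -> exists A, forall B, (A `<=` B)%fset ->
  `|rsum w - \sum_(i <- B) w i| <= e.
Proof.
move=> wM e e0; pose p i := Num.max (w i) 0; pose n i := Num.max (- w i) 0.
have p0 i : 0 <= p i by rewrite le_max lexx orbT.
have n0 i : 0 <= n i by rewrite le_max lexx orbT.
have pw i : p i <= `|w i| by rewrite ge_max ler_norm normr_ge0.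
have nw i : n i <= `|w i| by rewrite ge_max -normrN ler_norm normr_ge0.
have wE i : w i = p i - n i.
  have [h|h] := leP 0 (w i); rewrite /p /n.
    by rewrite (max_idPl h) (max_idPr _) ?oppr_le0 // subr0.
  by rewrite (max_idPr (ltW h)) (max_idPl _) ?oppr_ge0 ?(ltW h) // sub0r opprK.
have bnd f : (forall i, f i <= `|w i|) -> forall A, \sum_(i <- A) f i <= M.
  by move=> fw A; apply: le_trans (wM A); apply: ler_sum => i _.
have [_ p1 p2] := esum_fset_approx p0 (bnd _ pw).
have [_ n1 n2] := esum_fset_approx n0 (bnd _ nw).
have -> : rsum w = fine (\esum_(i in [set: T]) (p i)%:E)%E -
                   fine (\esum_(i in [set: T]) (n i)%:E)%E.
  rewrite /rsum; congr (fine _ - fine _); apply: eq_esum => i _.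
    by rewrite funeposE /= -EFin_max.
  by rewrite funenegE /= -EFin_max.
have [A1 h1] := p2 e e0; have [A2 h2] := n2 e e0.
exists (A1 `|` A2)%fset => B; rewrite fsubUset => /andP[B1 B2].
rewrite (eq_bigr _ (fun i _ => wE i)) sumrB ler_norml.
have := ler_fset_sum p0 B1; have := ler_fset_sum n0 B2.
by have := p1 B; have := n1 B; move: h1 h2; lra.
Qed.

(** The finite sums converge to the sum along the directed set of finite
    subsets; everything below about infinite sums rests on this and on
    uniqueness of the limit. *)
Lemma csum_approx u M : abs_le u M -> forall e : R, 0 < e ->
  exists A, forall B, (A `<=` B)%fset -> nc (csum u - \sum_(i <- B) u i) <= e.
Proof.
move=> uM e e0; have e2 : 0 < e / 2 by rewrite divr_gt0.
have [A1 h1] : exists A, forall B, (A `<=` B)%fset ->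
    `|rsum (fun i => complex.Re (u i)) - \sum_(i <- B) complex.Re (u i)| <= e / 2.
  apply: (rsum_approx (M := M)) e2 => A.
  by apply: le_trans (uM A); apply: ler_sum => i _; exact: nc_Re.
have [A2 h2] : exists A, forall B, (A `<=` B)%fset ->
    `|rsum (fun i => complex.Im (u i)) - \sum_(i <- B) complex.Im (u i)| <= e / 2.
  apply: (rsum_approx (M := M)) e2 => A.
  by apply: le_trans (uM A); apply: ler_sum => i _; exact: nc_Im.
exists (A1 `|` A2)%fset => B; rewrite fsubUset => /andP[B1 B2].
apply: le_trans (nc_le_ReIm _) _; rewrite (splitr e); apply: lerD.
  by rewrite raddfB /= Re_sum; exact: h1.
by rewrite raddfB /= Im_sum; exact: h2.
Qed.

Lemma csum_unique u M c : abs_le u M -> (forall e : R, 0 < e ->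
  exists A, forall B, (A `<=` B)%fset -> nc (c - \sum_(i <- B) u i) <= e) ->
  csum u = c.
Proof.
move=> uM ce; apply/eqP; rewrite -subr_eq0; apply/eqP/nc_small => e e0.
have e2 : 0 < e / 2 by rewrite divr_gt0.
have [A1 h1] := csum_approx uM e2; have [A2 h2] := ce _ e2.
have {}h1 := h1 (A1 `|` A2)%fset (fsubsetUl _ _).
have {}h2 := h2 (A1 `|` A2)%fset (fsubsetUr _ _).
rewrite -(subrK (\sum_(i <- (A1 `|` A2)%fset) u i) (csum u)) -addrA -(opprB c).
by apply: le_trans (ncB _ _) _; rewrite (splitr e); apply: lerD.
Qed.

(** A bound on the finite sums themselves, as opposed to the sums of moduli,
    passes to the infinite sum. *)
Lemma nc_csum_le u M (K : R) : abs_le u M ->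
  (forall A, nc (\sum_(i <- A) u i) <= K) -> nc (csum u) <= K.
Proof.
move=> uM uK; apply/ler_addgt0Pr => e e0.
have [A /(_ A (fsubset_refl _)) h] := csum_approx uM e0.
rewrite -(subrK (\sum_(i <- A) u i) (csum u)) addrC.
by apply: le_trans (ncD _ _) _; apply: lerD.
Qed.

Lemma abs_leD u v M N : abs_le u M -> abs_le v N -> abs_le (fun i => u i + v i) (M + N).
Proof.
move=> uM vN A; apply: le_trans (lerD (uM A) (vN A)); rewrite -big_split /=.
by apply: ler_sum => i _; exact: ncD.
Qed.

Lemma abs_leZ k u M : abs_le u M -> abs_le (fun i => k * u i) (nc k * M).
Proof.
move=> uM A; apply: le_trans (ler_wpM2l (nc_ge0 k) (uM A)).
by rewrite mulr_sumr; apply: ler_sum => i _; rewrite ncM.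
Qed.

Lemma abs_leJ u M : abs_le u M -> abs_le (fun i => conjc (u i)) M.
Proof.
by move=> uM A; apply: le_trans (uM A); apply: ler_sum => i _; rewrite ncJ.
Qed.

Lemma abs_le_sum (I : Type) (s : seq I) (u : I -> T -> R[i]) (M : I -> R) :
  (forall j, abs_le (u j) (M j)) ->
  abs_le (fun i => \sum_(j <- s) u j i) (\sum_(j <- s) M j).
Proof.
move=> uM A; apply: (@le_trans _ _ (\sum_(i <- A) \sum_(j <- s) nc (u j i))).
  by apply: ler_sum => i _; exact: nc_sum.
by rewrite exchange_big /=; apply: ler_sum => j _; exact: uM.
Qed.

Lemma abs_le_supp u A : (forall i, i \notin A -> u i = 0) ->
  abs_le u (\sum_(i <- A) nc (u i)).
Proof.
move=> uA B.
have : \sum_(i <- B) nc (u i) <= \sum_(i <- (A `|` B)%fset) nc (u i).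
  by apply: ler_fset_sum; [move=> i; exact: nc_ge0|exact: fsubsetUr].
move=> h; apply: le_trans h _; rewrite le_eqVlt; apply/orP; left; apply/eqP.
apply/esym/big_fset_incl => [|i _ /uA ->]; last exact: nc0.
exact: fsubsetUl.
Qed.

Lemma abs_le_inj (T' : choiceType) (h : T' -> T) u M : injective h ->
  abs_le u M -> forall A' : {fset T'}, \sum_(i <- A') nc (u (h i)) <= M.
Proof.
move=> hi uM A'; have := uM [fset h i | i in A']%fset.
by rewrite big_imfset //= => i j _ _ /hi.
Qed.

Lemma csum_supp u A : (forall i, i \notin A -> u i = 0) ->
  csum u = \sum_(i <- A) u i.
Proof.
move=> uA; have sumE B : (A `<=` B)%fset -> \sum_(i <- B) u i = \sum_(i <- A) u i.
  move=> AB; apply/esym/big_fset_incl => // i _; exact: uA.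
apply: (csum_unique (abs_le_supp uA)) => e e0.
by exists A => B /sumE ->; rewrite subrr nc0 ltW.
Qed.

Lemma csumD u v M N : abs_le u M -> abs_le v N ->
  csum (fun i => u i + v i) = csum u + csum v.
Proof.
move=> uM vN; apply: (csum_unique (abs_leD uM vN)) => e e0.
have e2 : 0 < e / 2 by rewrite divr_gt0.
have [A1 h1] := csum_approx uM e2; have [A2 h2] := csum_approx vN e2.
exists (A1 `|` A2)%fset => B; rewrite fsubUset => /andP[B1 B2].
rewrite big_split /= opprD addrACA; apply: le_trans (ncD _ _) _.
by rewrite (splitr e); apply: lerD; [exact: h1|exact: h2].
Qed.

Lemma csumZ k u M : abs_le u M -> csum (fun i => k * u i) = k * csum u.
Proof.
move=> uM; apply: (csum_unique (abs_leZ k uM)) => e e0.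
have k0 : 0 < nc k + 1 by rewrite ltr_wpDl // nc_ge0.
have [A h] := csum_approx uM (divr_gt0 e0 k0); exists A => B /h {}h.
rewrite -mulr_sumr -mulrBr ncM; apply: le_trans (ler_wpM2l (nc_ge0 _) h) _.
by rewrite mulrCA ler_piMr ?(ltW e0) // ler_pdivrMr // mul1r lerDl.
Qed.

Lemma csumJ u M : abs_le u M -> csum (fun i => conjc (u i)) = conjc (csum u).
Proof.
move=> uM; apply: (csum_unique (abs_leJ uM)) => e e0.
have [A h] := csum_approx uM e0; exists A => B /h {}h.
by rewrite -rmorph_sum -rmorphB ncJ.
Qed.

Lemma csum_sum (I : Type) (s : seq I) (u : I -> T -> R[i]) (M : I -> R) :
  (forall j, abs_le (u j) (M j)) ->
  csum (fun i => \sum_(j <- s) u j i) = \sum_(j <- s) csum (u j).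
Proof.
move=> uM; elim: s => [|j s IH].
  rewrite big_nil (csum_supp (A := fset0)) ?big_seq_fset0 // => i _.
  by rewrite big_nil.
rewrite big_cons -IH -(csumD (uM j) (abs_le_sum s uM)).
by congr csum; apply/funext => i; rewrite big_cons.
Qed.

End absolute_sums.

Lemma csum_reindex (R : realType) (T T' : choiceType) (h : T -> T')
    (u : T' -> R[i]) : bijective h -> csum u = csum (fun i => u (h i)).
Proof.
move=> [g gK hK]; have hb : set_bij [set: T] [set: T'] h.
  split=> //; first by move=> x y _ _ /(can_inj gK).
  by move=> y _; exists (g y).
have rs (w : T' -> R) : rsum w = rsum (fun i => w (h i)).
  rewrite /rsum; rewrite !(@reindex_esum _ _ _ [set: T] [set: T'] h) //.
  by congr (fine _ - fine _); apply: eq_esum => i _; rewrite ?funeposE ?funenegE.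
by rewrite /csum (rs (fun x => complex.Re (u x))) (rs (fun x => complex.Im (u x))).
Qed.

(** * Bounded matrices *)

Section bounded_matrices.
Variables (R : realType) (T : choiceType).
Implicit Types (x y p q : T -> R[i]) (m n k : T -> T -> R[i]) (A B : {fset T}).

Definition sqsum A x : R := \sum_(i <- A) nc (x i) ^+ 2.

(** The square-summable families of norm at most X, when X is nonnegative. *)
Definition l2_le x (X : R) := forall A, sqsum A x <= X ^+ 2.

Definition mxform m A B x y : R[i] := \sum_(s <- B) \sum_(t <- A) m s t * x t * y s.

(** The matrix m defines an operator of norm at most M on l2(T). Testing the
    bilinear form on finite corners suffices and keeps infinite sums out
    of the definition. *)
Definition opbound m (M : R) := 0 <= M /\ forall A B x y (X Y : R),
  0 <= X -> 0 <= Y -> sqsum A x <= X ^+ 2 -> sqsum B y <= Y ^+ 2 ->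
  nc (mxform m A B x y) <= M * X * Y.

Lemma sqsum_ge0 A x : 0 <= sqsum A x.
Proof. by apply: sumr_ge0 => i _; exact: sqr_ge0. Qed.

Lemma sqsum0 A x i : sqsum A x <= 0 -> i \in A -> x i = 0.
Proof.
move=> h iA; have /eqP : sqsum A x = 0.
  by apply/eqP; rewrite eq_le h sqsum_ge0.
rewrite /sqsum (big_fsetD1 _ iA) /= paddr_eq0 ?sqr_ge0 ?sumr_ge0 // => [/andP[]|j _].
  by rewrite sqrf_eq0 => /eqP/nc_eq0.
exact: sqr_ge0.
Qed.

Lemma weighted_amgm (a b c : R) : 0 < c ->
  a * b <= 2^-1 * (c * a ^+ 2 + c^-1 * b ^+ 2).
Proof.
move=> c0; have -> : c * a ^+ 2 + c^-1 * b ^+ 2 =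
    c^-1 * (c * a - b) ^+ 2 + 2 * (a * b).
  by field; rewrite gt_eqF.
have : 0 <= c^-1 * (c * a - b) ^+ 2.
  by rewrite mulr_ge0 ?sqr_ge0 // invr_ge0 ltW.
lra.
Qed.

Lemma cauchy_schwarz A x y (X Y : R) : 0 <= X -> 0 <= Y ->
  sqsum A x <= X ^+ 2 -> sqsum A y <= Y ^+ 2 ->
  \sum_(i <- A) nc (x i) * nc (y i) <= X * Y.
Proof.
rewrite le_eqVlt => /predU1P[<- _|X0].
  rewrite expr0n /= => x0 _; rewrite mul0r big_seq big1 // => i iA.
  by rewrite (sqsum0 x0 iA) nc0 mul0r.
rewrite le_eqVlt => /predU1P[<- _|Y0].
  rewrite expr0n /= => y0; rewrite mulr0 big_seq big1 // => i iA.
  by rewrite (sqsum0 y0 iA) nc0 mulr0.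
move=> xX yY; pose c := Y / X; have c0 : 0 < c by rewrite divr_gt0.
have h i := weighted_amgm (nc (x i)) (nc (y i)) c0.
apply: le_trans (ler_sum _ (fun i _ => h i)) _.
rewrite -mulr_sumr big_split /= -!mulr_sumr -!/(sqsum _ _).
have h1 : c * sqsum A x <= X * Y.
  by apply: le_trans (ler_wpM2l (ltW c0) xX) _; rewrite /c expr2 mulrA divfK ?gt_eqF // mulrC.
have c1 : 0 <= c^-1 by rewrite invr_ge0 ltW.
have h2 : c^-1 * sqsum A y <= X * Y.
  by apply: le_trans (ler_wpM2l c1 yY) _; rewrite /c invf_div expr2 mulrA divfK ?gt_eqF.
by lra.
Qed.

(** The norm of a vector is attained on its own conjugate. *)
Lemma sqsum_dual A p (M : R) : 0 <= M -> (forall x (X : R), 0 <= X ->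
  sqsum A x <= X ^+ 2 -> nc (\sum_(i <- A) p i * x i) <= M * X) ->
  sqsum A p <= M ^+ 2.
Proof.
move=> M0 h; pose S := sqsum A p; have S0 : 0 <= S by exact: sqsum_ge0.
have := h (fun i => conjc (p i)) (Num.sqrt S) (sqrtr_ge0 _).
have -> : sqsum A (fun i => conjc (p i)) = S.
  by apply: eq_bigr => i _; rewrite ncJ.
have -> : \sum_(i <- A) p i * conjc (p i) = S%:C.
  by rewrite /S /sqsum rmorph_sum /=; apply: eq_bigr => i _; rewrite nc_sqr mulrC.
rewrite nc_real // sqr_sqrtr // lexx => /(_ isT); rewrite -/S.
have [->|S1] := eqVneq S 0; first by rewrite sqr_ge0.
have r0 : 0 < Num.sqrt S by rewrite sqrtr_gt0 lt_neqAle eq_sym S1.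
rewrite -{1 3}(sqr_sqrtr S0) expr2 ler_pM2r // => hS.
by rewrite -expr2 lerXn2r ?nnegrE ?(ltW r0).
Qed.

Lemma l2_le_abs p q (P Q : R) : 0 <= P -> 0 <= Q -> l2_le p P -> l2_le q Q ->
  abs_le (fun i => p i * q i) (P * Q).
Proof.
move=> P0 Q0 pP qQ A; apply: le_trans (cauchy_schwarz P0 Q0 (pP A) (qQ A)).
by apply: ler_sum => i _; rewrite ncM.
Qed.

Lemma nc_csum_abs p (M : R) : abs_le p M -> nc (csum p) <= M.
Proof.
move=> pM; apply: (nc_csum_le pM) => A; apply: le_trans (nc_sum _ _) _.
exact: pM.
Qed.

Lemma opbound_pos m (M : R) : 0 <= M -> (forall A B x y (X Y : R),
  0 < X -> 0 < Y -> sqsum A x <= X ^+ 2 -> sqsum B y <= Y ^+ 2 ->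
  nc (mxform m A B x y) <= M * X * Y) -> opbound m M.
Proof.
move=> M0 h; split=> // A B x y X Y.
rewrite le_eqVlt => /predU1P[<- _|X0].
  rewrite expr0n /= => x0 _; rewrite mulr0 mul0r /mxform big1 ?nc0 // => s _.
  by rewrite big_seq big1 // => t tA; rewrite (sqsum0 x0 tA) mulr0 mul0r.
rewrite le_eqVlt => /predU1P[<- _|Y0].
  rewrite expr0n /= => y0; rewrite mulr0 /mxform big_seq big1 ?nc0 // => s sB.
  by rewrite big1 // => t _; rewrite (sqsum0 y0 sB) mulr0.
exact: h.
Qed.

(** Weighted arithmetic-geometric means split each term of the form into a
    part controlled by the column sums and a part controlled by the row sums. *)
Lemma schur_test m (M : R) :
  (forall t B, \sum_(s <- B) nc (m s t) <= M) ->
  (forall s A, \sum_(t <- A) nc (m s t) <= M) -> 0 <= M -> opbound m M.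
Proof.
move=> colM rowM M0; apply: opbound_pos => // A B x y X Y X0 Y0 xX yY.
pose c := Y / X; have c0 : 0 < c by rewrite divr_gt0.
have ci0 : 0 <= c^-1 by rewrite invr_ge0 ltW.
pose f s t := nc (m s t) * (c * nc (x t) ^+ 2).
pose g s t := nc (m s t) * (c^-1 * nc (y s) ^+ 2).
have fM : \sum_(s <- B) \sum_(t <- A) f s t <= M * X * Y.
  rewrite exchange_big /=; apply: (@le_trans _ _ (\sum_(t <- A) M * (c * nc (x t) ^+ 2))).
    apply: ler_sum => t _; rewrite -mulr_suml ler_wpM2r //.
    by rewrite mulr_ge0 ?sqr_ge0 // ltW.
  rewrite -mulr_sumr -mulr_sumr -mulrA ler_wpM2l //.
  apply: le_trans (ler_wpM2l (ltW c0) xX) _.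
  by rewrite /c expr2 mulrA divfK ?gt_eqF // mulrC.
have gM : \sum_(s <- B) \sum_(t <- A) g s t <= M * X * Y.
  apply: (@le_trans _ _ (\sum_(s <- B) M * (c^-1 * nc (y s) ^+ 2))).
    apply: ler_sum => s _; rewrite -mulr_suml ler_wpM2r //.
    by rewrite mulr_ge0 ?sqr_ge0.
  rewrite -mulr_sumr -mulr_sumr -mulrA ler_wpM2l //.
  apply: le_trans (ler_wpM2l ci0 yY) _.
  by rewrite /c invf_div expr2 mulrA divfK ?gt_eqF.
apply: (@le_trans _ _ (2^-1 * (\sum_(s <- B) \sum_(t <- A) f s t +
                              \sum_(s <- B) \sum_(t <- A) g s t))); last by lra.
rewrite -big_split /= mulr_sumr; apply: le_trans (nc_sum _ _) _.
apply: ler_sum => s _; rewrite -big_split /= mulr_sumr.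
apply: le_trans (nc_sum _ _) _; apply: ler_sum => t _.
rewrite !ncM /f /g -mulrDr mulrCA -mulrA ler_wpM2l ?nc_ge0 //.
exact: weighted_amgm.
Qed.

Lemma opbound_trans m M : opbound m M -> opbound (fun s t => m t s) M.
Proof.
move=> [M0 h]; split=> // A B x y X Y X0 Y0 xX yY.
rewrite -mulrA [X * Y]mulrC mulrA; apply: le_trans (h B A y x Y X Y0 X0 yY xX).
rewrite /mxform exchange_big /=.
by under eq_bigr => s _ do under eq_bigr => t _ do rewrite mulrAC.
Qed.

Lemma opbound_conj m M : opbound m M -> opbound (fun s t => conjc (m s t)) M.
Proof.
move=> [M0 h]; split=> // A B x y X Y X0 Y0 xX yY.
have sJ C z : sqsum C (fun i => conjc (z i)) = sqsum C z.
  by apply: eq_bigr => i _; rewrite ncJ.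
rewrite -(sJ A) in xX; rewrite -(sJ B) in yY.
apply: le_trans (h _ _ _ _ _ _ X0 Y0 xX yY); rewrite -ncJ /mxform rmorph_sum /=.
under eq_bigr => s _ do rewrite rmorph_sum /=.
by under eq_bigr => s _ do under eq_bigr => t _ do rewrite !rmorphM /= conjcK.
Qed.

Definition mxstar m : T -> T -> R[i] := fun s t => conjc (m t s).

Lemma opbound_star m M : opbound m M -> opbound (mxstar m) M.
Proof. by move=> /opbound_conj /opbound_trans. Qed.

Lemma col_sum_l2 m (M : R) A x (X : R) : opbound m M -> 0 <= X ->
  sqsum A x <= X ^+ 2 -> l2_le (fun s => \sum_(t <- A) m s t * x t) (M * X).
Proof.
move=> [M0 h] X0 xX B; apply: sqsum_dual => [|y Y Y0 yY]; first exact: mulr_ge0.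
apply: le_trans (h _ _ _ _ _ _ X0 Y0 xX yY); rewrite /mxform.
by under eq_bigr => s _ do rewrite mulr_suml.
Qed.

Lemma row_sum_l2 m (M : R) B y (Y : R) : opbound m M -> 0 <= Y ->
  sqsum B y <= Y ^+ 2 -> l2_le (fun t => \sum_(s <- B) m s t * y s) (M * Y).
Proof. by move=> /opbound_trans; exact: col_sum_l2. Qed.

Lemma col_l2 m (M : R) t : opbound m M -> l2_le (fun s => m s t) M.
Proof.
move=> mM; have s1 : sqsum [fset t]%fset (fun=> 1) <= 1 ^+ 2.
  by rewrite /sqsum big_seq_fset1 /nc /= expr0n addr0 expr1n sqrtr1 expr1n.
have := col_sum_l2 mM ler01 s1; rewrite mulr1.
by rewrite (_ : (fun s => _) = (fun s => m s t)) // funeqE => s; rewrite big_seq_fset1 mulr1.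
Qed.

Lemma row_l2 m (M : R) s : opbound m M -> l2_le (m s) M.
Proof. by move=> /opbound_trans; exact: col_l2. Qed.

Definition mxapply m x : T -> R[i] := fun s => csum (fun t => m s t * x t).

Lemma row_apply_abs m x (M X : R) s : opbound m M -> 0 <= X -> l2_le x X ->
  abs_le (fun t => m s t * x t) (M * X).
Proof.
move=> mM X0 xX; apply: l2_le_abs => //; first by case: mM.
exact: row_l2.
Qed.

(** By duality it is enough to pair with finitely supported y, and then the
    sum over rows can be taken first. *)
Lemma mxapply_l2 m x (M X : R) : opbound m M -> 0 <= X -> l2_le x X ->
  l2_le (mxapply m x) (M * X).
Proof.
move=> mM X0 xX B; have [M0 _] := mM.
apply: sqsum_dual => [|y Y Y0 yY]; first exact: mulr_ge0.
have -> : \sum_(s <- B) mxapply m x s * y s =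
    csum (fun t => (\sum_(s <- B) m s t * y s) * x t).
  under eq_bigr => s _.
    rewrite mulrC -(csumZ _ (row_apply_abs s mM X0 xX)); over.
  rewrite -(@csum_sum R T _ _ _ (fun s => nc (y s) * (M * X))); last first.
    by move=> s; apply: abs_leZ; exact: row_apply_abs.
  congr csum; apply/funext => t; rewrite mulr_suml.
  by apply: eq_bigr => s _; rewrite mulrCA mulrA.
rewrite mulrAC; apply: nc_csum_abs; apply: l2_le_abs => //.
  exact: mulr_ge0.
exact: row_sum_l2.
Qed.

Definition mxprod m n : T -> T -> R[i] := fun s t => csum (fun u => m s u * n u t).

Lemma mxprod_abs m n (M N : R) s t : opbound m M -> opbound n N ->
  abs_le (fun u => m s u * n u t) (M * N).
Proof.
move=> mM nN; apply: row_apply_abs => //; first by case: nN.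
exact: col_l2.
Qed.

Lemma mxform_prod m n (M N : R) A B x y : opbound m M -> opbound n N ->
  mxform (mxprod m n) A B x y =
  csum (fun u => (\sum_(s <- B) m s u * y s) * (\sum_(t <- A) n u t * x t)).
Proof.
move=> mM nN; rewrite /mxform.
under eq_bigr => s _.
  under eq_bigr => t _.
    rewrite -mulrA mulrC -(csumZ (x t * y s) (mxprod_abs s t mM nN)); over.
  rewrite -(@csum_sum R T _ _ _ (fun t => nc (x t * y s) * (M * N))); last first.
    by move=> t; apply: abs_leZ; exact: mxprod_abs.
  over.
rewrite -(@csum_sum R T _ _ _ (fun s => \sum_(t <- A) nc (x t * y s) * (M * N))); last first.
  by move=> s; apply: abs_le_sum => t; apply: abs_leZ; exact: mxprod_abs.
congr csum; apply/funext => u; rewrite mulr_suml.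
apply: eq_bigr => s _; rewrite mulr_sumr; apply: eq_bigr => t _.
by ring.
Qed.

Lemma opbound_prod m n (M N : R) : opbound m M -> opbound n N ->
  opbound (mxprod m n) (M * N).
Proof.
move=> mM nN; have [M0 _] := mM; have [N0 _] := nN.
split=> [|A B x y X Y X0 Y0 xX yY]; first exact: mulr_ge0.
rewrite (mxform_prod _ _ _ _ mM nN).
have -> : M * N * X * Y = (M * Y) * (N * X) by ring.
apply: nc_csum_abs; apply: l2_le_abs; rewrite ?mulr_ge0 //.
  exact: row_sum_l2.
exact: col_sum_l2.
Qed.

(** Finitely supported families are dense in l2(T). *)
Lemma l2_tail x (X : R) : l2_le x X -> forall e : R, 0 < e -> exists A,
  l2_le (fun i => if i \in A then 0 else x i) e.
Proof.
move=> xX e e0.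
have [A h] := fset_sum_tail (fun i => sqr_ge0 (nc (x i))) xX (exprn_gt0 2 e0).
exists A => B; rewrite /sqsum (big_fsetID _ (mem A)) /= big_seq big1 ?add0r.
  rewrite [leLHS]big_seq; under eq_bigr => i.
    by rewrite !inE => /andP[_ /negbTE ->]; over.
  by rewrite -big_seq; apply: h => i; rewrite !inE => /andP[].
by move=> i; rewrite !inE => /andP[_ ->]; rewrite nc0 expr0n.
Qed.

(** The double sum need not converge absolutely, so the order of summation is
    exchanged by continuity: for x of finite support it is linearity of the
    sum, and both sides are bounded by N P times the norm of x. *)
Lemma mxapply_pairing n r x (N P X : R) : opbound n N -> 0 <= P -> 0 <= X ->
  l2_le r P -> l2_le x X ->
  csum (fun u => mxapply (fun s t => n t s) r u * x u) =
  csum (fun v => r v * mxapply n x v).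
Proof.
move=> nN P0 X0 rP xX; have [N0 _] := nN.
have nT := opbound_trans nN.
have cP := mxapply_l2 nT P0 rP; set c := mxapply (fun s t => n t s) r in cP *.
have dX := mxapply_l2 nN X0 xX.
have cx := l2_le_abs (mulr_ge0 N0 P0) X0 cP xX.
apply/eqP; rewrite -subr_eq0; apply/eqP/nc_small => e e0.
have k0 : 0 < 2 * (N * P) + 1 by rewrite ltr_wpDl // !mulr_ge0.
have [A hA] := l2_tail xX (divr_gt0 e0 k0).
set d := e / _ in hA; have d0 : 0 <= d by rewrite ltW // divr_gt0.
pose x1 i := if i \in A then x i else 0.
pose x2 i := if i \in A then 0 else x i.
have xE i : x i = x1 i + x2 i by rewrite /x1 /x2; case: ifP; rewrite ?addr0 ?add0r.
have x1X : l2_le x1 X.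
  move=> B; apply: le_trans (xX B); apply: ler_sum => i _; rewrite /x1.
  by case: ifP => // _; rewrite nc0 expr0n sqr_ge0.
have mx1 v : mxapply n x1 v = \sum_(u <- A) n v u * x u.
  rewrite /mxapply (csum_supp (A := A)); last first.
    by move=> i /negbTE iA; rewrite /x1 iA mulr0.
  by rewrite big_seq [RHS]big_seq; apply: eq_bigr => i iA; rewrite /x1 iA.
have fin : csum (fun u => c u * x1 u) = csum (fun v => r v * mxapply n x1 v).
  rewrite (csum_supp (A := A)); last by move=> i /negbTE iA; rewrite /x1 iA mulr0.
  rewrite big_seq; under eq_bigr => u uA.
    rewrite /x1 uA /c /mxapply mulrC -(csumZ _ (row_apply_abs u nT P0 rP)); over.
  rewrite -big_seq -(@csum_sum R T _ _ _ (fun u => nc (x u) * (N * P))); last first.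
    by move=> u; apply: abs_leZ; exact: row_apply_abs nT P0 rP.
  congr csum; apply/funext => v; rewrite mx1 mulr_sumr.
  by apply: eq_bigr => u _; ring.
have cx1 := l2_le_abs (mulr_ge0 N0 P0) X0 cP x1X.
have cx2 := l2_le_abs (mulr_ge0 N0 P0) d0 cP hA.
have rx1 := l2_le_abs P0 (mulr_ge0 N0 X0) rP (mxapply_l2 nN X0 x1X).
have rx2 := l2_le_abs P0 (mulr_ge0 N0 d0) rP (mxapply_l2 nN d0 hA).
have -> : csum (fun u => c u * x u) = csum (fun u => c u * x1 u) + csum (fun u => c u * x2 u).
  by rewrite -(csumD cx1 cx2); congr csum; apply/funext => u; rewrite -mulrDr -xE.
have -> : csum (fun v => r v * mxapply n x v) =
    csum (fun v => r v * mxapply n x1 v) + csum (fun v => r v * mxapply n x2 v).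
  rewrite -(csumD rx1 rx2); congr csum; apply/funext => v; rewrite -mulrDr.
  rewrite /mxapply -(csumD (row_apply_abs v nN X0 x1X) (row_apply_abs v nN d0 hA)).
  by congr (_ * csum _); apply/funext => u; rewrite -mulrDr -xE.
rewrite fin opprD addrACA subrr add0r.
apply: le_trans (ncB _ _) _.
apply: le_trans (lerD (nc_csum_abs cx2) (nc_csum_abs rx2)) _.
have -> : N * P * d + P * (N * d) = e * ((2 * (N * P)) / (2 * (N * P) + 1)).
  by rewrite /d; field; rewrite gt_eqF.
rewrite ler_piMr ?(ltW e0) // ler_pdivrMr // mul1r lerDl //.
Qed.

(** Row s of m and column t of k are square-summable, so this is an instance
    of mxapply_pairing. *)
Lemma mxprodA m n k (M N K : R) : opbound m M -> opbound n N -> opbound k K ->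
  mxprod m (mxprod n k) = mxprod (mxprod m n) k.
Proof.
move=> mM nN kK; apply/funext => s; apply/funext => t.
have [M0 _] := mM; have [K0 _] := kK.
have := mxapply_pairing nN M0 K0 (row_l2 s mM) (col_l2 t kK).
rewrite /mxprod /mxapply => <-; congr csum; apply/funext => u; congr (_ * _).
by congr csum; apply/funext => v; rewrite mulrC.
Qed.

Lemma mxstar_prod m n (M N : R) : opbound m M -> opbound n N ->
  mxstar (mxprod m n) = mxprod (mxstar n) (mxstar m).
Proof.
move=> mM nN; apply/funext => s; apply/funext => t.
rewrite /mxstar /mxprod -(csumJ (mxprod_abs t s mM nN)).
by congr csum; apply/funext => u; rewrite rmorphM mulrC.
Qed.

(** The form of m* m at x and its conjugate is the squared norm of m x, which
    dominates its finite partial sums. *)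
Lemma opbound_cstar m (M K : R) : opbound m M ->
  opbound (mxprod (mxstar m) m) (K ^+ 2) -> 0 <= K -> opbound m K.
Proof.
move=> mM [_ h] K0; split=> // A B x y X Y X0 Y0 xX yY.
pose z s := \sum_(t <- A) m s t * x t.
have zl2 : l2_le z (M * X) by exact: col_sum_l2.
have zK : sqsum B z <= (K * X) ^+ 2.
  pose f s := ((nc (z s)) ^+ 2)%:C.
  have fabs : abs_le f ((M * X) ^+ 2).
    move=> C; apply: le_trans (zl2 C); apply: ler_sum => s _.
    by rewrite nc_real // sqr_ge0.
  have xJ : sqsum A (fun i => conjc (x i)) <= X ^+ 2.
    by apply: le_trans xX; apply: ler_sum => i _; rewrite ncJ.
  have := h A A x (fun i => conjc (x i)) X X X0 X0 xX xJ.
  rewrite (mxform_prod _ _ _ _ (opbound_star mM) mM).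
  have -> : (fun u => (\sum_(s <- A) mxstar m s u * conjc (x s)) *
                   (\sum_(t <- A) m u t * x t)) = f.
    apply/funext => u; rewrite /f nc_sqr -/(z u) /z rmorph_sum /=; congr (_ * _).
    by apply: eq_bigr => t _; rewrite rmorphM.
  rewrite exprMn [X ^+ 2]expr2 mulrA; apply: le_trans.
  apply/ler_addgt0Pr => e e0; have [C hC] := csum_approx fabs e0.
  have := hC (C `|` B)%fset (fsubsetUl _ _).
  rewrite /f -rmorph_sum -/(sqsum _ _) => {}hC.
  apply: (@le_trans _ _ (sqsum (C `|` B)%fset z)).
    by apply: ler_fset_sum; [move=> i; exact: sqr_ge0|exact: fsubsetUr].
  rewrite -[leLHS]nc_real ?sqsum_ge0 //.
  rewrite -(subrK (csum f) (sqsum _ _)%:C) addrC; apply: le_trans (ncD _ _) _.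
  by rewrite lerD2l -ncN opprB.
have -> : mxform m A B x y = \sum_(s <- B) z s * y s.
  by apply: eq_bigr => s _; rewrite mulr_suml.
apply: le_trans (nc_sum _ _) _; under eq_bigr => s _ do rewrite ncM.
exact: cauchy_schwarz (mulr_ge0 K0 X0) Y0 zK yY.
Qed.

End bounded_matrices.

(** * The C*-algebra of bounded matrices *)

Section opbound_module.
Variables (R : realType) (T : choiceType).
Implicit Types (m n k : T -> T -> R[i]).

Lemma opbound0 : opbound (0 : T -> T -> R[i]) 0.
Proof.
split=> // A B x y X Y _ _ _ _; have -> : mxform 0 A B x y = 0; last by rewrite nc0 !mul0r.
by apply: big1 => s _; apply: big1 => t _; rewrite [X in X * _ * _](_ : _ = 0) // !mul0r.
Qed.

Lemma opboundD m n (M N : R) : opbound m M -> opbound n N -> opbound (m + n) (M + N).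
Proof.
move=> [M0 hm] [N0 hn]; split=> [|A B x y X Y X0 Y0 xX yY]; first exact: addr_ge0.
rewrite !mulrDl (_ : mxform _ A B x y = mxform m A B x y + mxform n A B x y); last first.
  rewrite /mxform -big_split /=; apply: eq_bigr => s _.
  by rewrite -big_split /=; apply: eq_bigr => t _; rewrite !mulrDl.
by apply: le_trans (ncD _ _) _; apply: lerD; [exact: hm|exact: hn].
Qed.

Lemma mxformZ c m A B x y : mxform (c *: m) A B x y = c * mxform m A B x y.
Proof.
rewrite /mxform mulr_sumr; apply: eq_bigr => s _.
by rewrite mulr_sumr; apply: eq_bigr => t _; rewrite !mulrA.
Qed.

Lemma opboundZ c m (M : R) : opbound m M -> opbound (c *: m) (nc c * M).
Proof.
move=> [M0 hm]; split=> [|A B x y X Y X0 Y0 xX yY]; first by rewrite mulr_ge0 ?nc_ge0.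
by rewrite mxformZ ncM -!mulrA ler_wpM2l ?nc_ge0 // mulrA; exact: hm.
Qed.

Definition in_bmat : {pred (T -> T -> R[i])} := fun m => `[< exists M, opbound m M >].

Fact in_bmat_submod : subsemimod_closed in_bmat.
Proof.
split; first split.
- by apply/asboolP; exists 0; exact: opbound0.
- move=> m n /asboolP[M mM] /asboolP[N nN]; apply/asboolP; exists (M + N).
  exact: opboundD.
- by move=> c m /asboolP[M mM]; apply/asboolP; exists (nc c * M); exact: opboundZ.
Qed.

HB.instance Definition _ :=
  GRing.isSubmodClosed.Build R[i] (T -> T -> R[i]) in_bmat in_bmat_submod.

End opbound_module.

Record bmat (R : realType) (T : choiceType) := Bmat {
  bmat_val :> T -> T -> R[i];
  bmatP : bmat_val \in @in_bmat R T
}.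

HB.instance Definition _ R T := [isSub for @bmat_val R T].
HB.instance Definition _ R T := [Choice of @bmat R T by <:].
HB.instance Definition _ R T := [SubChoice_isSubLmodule of @bmat R T by <:].

Section bmat_norm.
Variables (R : realType) (T : choiceType).
Implicit Types (m n k : bmat R T).

Lemma bmatZE (c : R[i]) m : bmat_val (c *: m) = c *: bmat_val m.
Proof. by []. Qed.

Lemma bmatDE m n : bmat_val (m + n) = bmat_val m + bmat_val n.
Proof. by []. Qed.

Lemma bmat_bounded m : exists M, opbound m M.
Proof. exact/asboolP/bmatP. Qed.

(** The infimum is attained, see opbound_opnorm. *)
Definition opnorm m : R := inf [set M | opbound m M].

Let has_inf_opbound m : has_inf [set M | opbound m M].
Proof.
split; first exact: bmat_bounded.
by exists 0 => M [].
Qed.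

Lemma opnorm_le m (M : R) : opbound m M -> opnorm m <= M.
Proof. by move=> mM; apply: ge_inf => //; case: (has_inf_opbound m). Qed.

Lemma opnorm_ge0 m : 0 <= opnorm m.
Proof. by apply: lb_le_inf; [exact: bmat_bounded|move=> M []]. Qed.

Lemma opbound_opnorm m : opbound m (opnorm m).
Proof.
split=> [|A B x y X Y X0 Y0 xX yY]; first exact: opnorm_ge0.
apply/ler_addgt0Pr => e e0.
have k0 : 0 < X * Y + 1 by rewrite ltr_wpDl // mulr_ge0.
have [M [M0 hM] Mlt] := inf_adherent (divr_gt0 e0 k0) (has_inf_opbound m).
apply: le_trans (hM _ _ _ _ _ _ X0 Y0 xX yY) _.
apply: (@le_trans _ _ ((opnorm m + e / (X * Y + 1)) * (X * Y))).
  by rewrite -mulrA ler_wpM2r ?mulr_ge0 // ltW.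
rewrite mulrDl mulrA lerD2l mulrAC -mulrA ler_piMr ?(ltW e0) //.
by rewrite ler_pdivrMr // mul1r lerDl.
Qed.

Lemma nc_entry_le m s t : nc (m s t) <= opnorm m.
Proof.
have := row_l2 s (opbound_opnorm m) [fset t]%fset; rewrite /sqsum big_seq_fset1.
by rewrite ler_sqr ?nnegrE ?nc_ge0 ?opnorm_ge0.
Qed.

Definition bnorm m : R[i] := (opnorm m)%:C.

Fact bnormD m n : bnorm (m + n) <= bnorm m + bnorm n.
Proof.
rewrite /bnorm -rmorphD lecR; apply: opnorm_le.
exact: opboundD (opbound_opnorm m) (opbound_opnorm n).
Qed.

Let opnormZ_le (c : R[i]) m : opnorm (c *: m) <= nc c * opnorm m.
Proof.
have h : opbound (bmat_val (c *: m)) (nc c * opnorm m).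
  by rewrite bmatZE; exact: opboundZ (opbound_opnorm m).
exact: opnorm_le h.
Qed.

Fact bnormZ (c : R[i]) m : bnorm (c *: m) = `|c| * bnorm m.
Proof.
rewrite ncE /bnorm -rmorphM; congr (_%:C).
apply/eqP; rewrite eq_le opnormZ_le /=.
have [->|c0] := eqVneq c 0; first by rewrite nc0 mul0r opnorm_ge0.
have c1 : 0 < nc c.
  by rewrite lt_neqAle nc_ge0 andbT eq_sym; apply: contra_neq c0; exact: nc_eq0.
have := opnormZ_le c^-1 (c *: m); rewrite scalerA mulVf // scale1r.
by rewrite (Normc.normcV c : nc _ = _) ler_pdivlMl.
Qed.

Fact bnorm_eq0 m : bnorm m = 0 -> m = 0.
Proof.
move=> /(congr1 (@complex.Re R)) /= m0; apply/val_inj/funext => s; apply/funext => t.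
by apply/nc_eq0/eqP; rewrite eq_le nc_ge0 andbT -m0 nc_entry_le.
Qed.

HB.instance Definition _ :=
  Lmodule_isNormed.Build R[i] (bmat R T) bnormD bnormZ bnorm_eq0.

Lemma bmat_normE m : `|m| = (opnorm m)%:C.
Proof. by []. Qed.

Lemma ball_opnormE m (e : R[i]) n : ball m e n -> opnorm (m - n) < complex.Re e.
Proof.
by rewrite -ball_normE /= bmat_normE; case: e => a b; rewrite ltcE /= => /andP[].
Qed.

Lemma real_cauchy_limit (F : set_system (bmat R T)) (f : bmat R T -> R) :
  ProperFilter F -> cauchy F ->
  (forall m n, `|f m - f n| <= opnorm (m - n)) ->
  exists l : R, forall e : R, 0 < e -> F [set m | `|l - f m| <= e].
Proof.
move=> FF Fc fl.
have : cauchy (f @ F).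
  apply/cauchyP => e e0.
  have [|m Fm] := (cauchyP F).1 Fc e%:C; first by rewrite ltcR.
  exists (f m); suff : F (f @^-1` ball (f m) e) by [].
  apply: filterS Fm => n /ball_opnormE /= mn.
  by rewrite -ball_normE /=; apply: le_lt_trans (fl _ _) mn.
move/(@R_complete R (f @ F)) => /cvg_ex[l /cvgrPdist_le fl']; exists l => e e0.
exact: fl'.
Qed.

(** Entries converge because they are bounded by the norm. Each form on a
    finite corner depends on finitely many entries, so the bounds defining the
    operator norm pass to the entrywise limit. *)
Fact bmat_complete (F : set_system (bmat R T)) :
  ProperFilter F -> cauchy F -> cvg F.
Proof.
move=> FF Fc.
have opC m n s t : nc (m s t - n s t) <= opnorm (m - n) by exact: (nc_entry_le (m - n)).
have lim s t : exists l : R[i], forall e : R, 0 < e ->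
      F [set m | nc (l - bmat_val m s t) <= e].
  have [|a ha] := real_cauchy_limit (f := fun m => complex.Re (m s t)) FF Fc.
    by move=> m n; rewrite -raddfB; apply: le_trans (nc_Re _) (opC m n s t).
  have [|b hb] := real_cauchy_limit (f := fun m => complex.Im (m s t)) FF Fc.
    by move=> m n; rewrite -raddfB; apply: le_trans (nc_Im _) (opC m n s t).
  exists (a +i* b) => e e0; have e2 : 0 < e / 2 by rewrite divr_gt0.
  apply: filterS2 (ha _ e2) (hb _ e2) => m h1 h2 /=.
  apply: le_trans (nc_le_ReIm _) _; rewrite (splitr e).
  by apply: lerD; move: h1 h2 => /=; case: (bmat_val m s t).
pose L s t := sval (cid (lim s t)).
have LP s t (e : R) : 0 < e -> F [set m | nc (L s t - bmat_val m s t) <= e].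
  by move=> e0; rewrite /L; case: cid => l /= /(_ e e0).
have close (A B : {fset T}) (e : R) : 0 < e ->
    F [set m | forall s t, s \in B -> t \in A -> nc (L s t - bmat_val m s t) <= e].
  move=> e0.
  have h s : F (\bigcap_(t in [set` A]) [set m | nc (L s t - bmat_val m s t) <= e]).
    by apply: filter_bigI => t _; exact: LP.
  have : F (\bigcap_(s in [set` B]) \bigcap_(t in [set` A])
      [set m | nc (L s t - bmat_val m s t) <= e]) by apply: filter_bigI => s _.
  by apply: filterS => m hm s t sB tA; exact: hm.
have dist m (e : R) : 0 < e -> F (ball m e%:C) -> opbound (L - bmat_val m) e.
  move=> e0 Fm; split=> [|A B x y X Y X0 Y0 xX yY]; first exact: ltW.
  apply/ler_addgt0Pr => d d0.
  pose C := \sum_(s <- B) \sum_(t <- A) nc (x t) * nc (y s).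
  have C0 : 0 <= C.
    by apply: sumr_ge0 => s _; apply: sumr_ge0 => t _; rewrite mulr_ge0 ?nc_ge0.
  have C1 : 0 < C + 1 by rewrite ltr_wpDl.
  have [n [nm nL]] := filter_ex (filterI Fm (close A B _ (divr_gt0 d0 C1))).
  have -> : mxform (L - bmat_val m) A B x y =
      mxform (L - bmat_val n) A B x y - mxform (bmat_val (m - n)) A B x y.
    rewrite /mxform -sumrB; apply: eq_bigr => s _; rewrite -sumrB.
    apply: eq_bigr => t _; rewrite -!mulrBl; congr (_ * _ * _).
    rewrite [bmat_val (m - n) s t](_ : _ = bmat_val m s t - bmat_val n s t) //.
    rewrite [(L - bmat_val m) s t](_ : _ = L s t - bmat_val m s t) //.
    rewrite [(L - bmat_val n) s t](_ : _ = L s t - bmat_val n s t) //.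
    by rewrite opprB addrA subrK.
  apply: le_trans (ncB _ _) _; rewrite addrC; apply: lerD.
    have [_ h] := opbound_opnorm (m - n).
    apply: le_trans (h _ _ _ _ _ _ X0 Y0 xX yY) _.
    by rewrite -!mulrA ler_wpM2r ?mulr_ge0 // ltW // (ball_opnormE nm).
  apply: (@le_trans _ _ (d / (C + 1) * C)).
    rewrite /C mulr_sumr; apply: le_trans (nc_sum _ _) _.
    rewrite big_seq [leRHS]big_seq; apply: ler_sum => s sB.
    rewrite mulr_sumr; apply: le_trans (nc_sum _ _) _.
    rewrite big_seq [leRHS]big_seq; apply: ler_sum => t tA.
    rewrite -mulrA !ncM ler_wpM2r ?mulr_ge0 ?nc_ge0 //.
    exact: nL.
  by rewrite mulrAC -mulrA ler_piMr ?(ltW d0) // ler_pdivrMr // mul1r lerDl.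
have [|m0 Fm0] := (cauchyP F).1 Fc (1 : R)%:C; first by rewrite ltcR.
have Lb : L \in @in_bmat R T.
  apply/asboolP; exists (1 + opnorm m0); rewrite -(subrK (bmat_val m0) L).
  exact: opboundD (dist _ _ ltr01 Fm0) (opbound_opnorm m0).
apply/cvg_ex; exists (Bmat Lb); apply/cvgrPdist_le => e e0.
have [r re r0] := gt0_complexR e0.
have r2 : 0 < r / 2 by rewrite divr_gt0.
have [|m Fm] := (cauchyP F).1 Fc (r / 2)%:C; first by rewrite ltcR.
apply: filterS (Fm) => n /ball_opnormE /= mn; rewrite re bmat_normE lecR.
have -> : Bmat Lb - n = (Bmat Lb - m) + (m - n) by rewrite addrA subrK.
have := bnormD (Bmat Lb - m) (m - n); rewrite /bnorm -rmorphD lecR => h.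
apply: le_trans h _; rewrite (splitr r); apply: lerD; last exact: ltW.
have mL : opbound (bmat_val (Bmat Lb - m)) (r / 2) by exact: (dist _ _ r2 Fm).
exact: opnorm_le mL.
Qed.

HB.instance Definition _ := Uniform_isComplete.Build (bmat R T) bmat_complete.

Fact bmul_subproof m n : mxprod m n \in @in_bmat R T.
Proof.
by apply/asboolP; exists (opnorm m * opnorm n); apply: opbound_prod; exact: opbound_opnorm.
Qed.

Fact bstar_subproof m : mxstar m \in @in_bmat R T.
Proof. by apply/asboolP; exists (opnorm m); apply: opbound_star; exact: opbound_opnorm. Qed.

Definition bmul m n := Bmat (bmul_subproof m n).
Definition bstar m := Bmat (bstar_subproof m).

HB.instance Definition _ := hasMulStar.Build R (bmat R T) bmul bstar.

Lemma bmat_eqP m n : (forall s t, bmat_val m s t = bmat_val n s t) -> m = n.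
Proof. by move=> mn; apply/val_inj/funext => s; apply/funext => t; exact: mn. Qed.

Let prod_abs m n s t : abs_le (fun u => bmat_val m s u * bmat_val n u t)
  (opnorm m * opnorm n).
Proof. by apply: mxprod_abs; exact: opbound_opnorm. Qed.

Fact bmulA : associative bmul.
Proof.
move=> m n k; apply/val_inj => /=.
exact: mxprodA (opbound_opnorm m) (opbound_opnorm n) (opbound_opnorm k).
Qed.

Fact bmulDl : left_distributive bmul +%R.
Proof.
move=> m n k; apply: bmat_eqP => s t.
rewrite -[RHS](csumD (prod_abs m k s t) (prod_abs n k s t)).
by congr csum; apply/funext => u; rewrite -mulrDl bmatDE.
Qed.

Fact bmulDr : right_distributive bmul +%R.
Proof.
move=> m n k; apply: bmat_eqP => s t.
rewrite -[RHS](csumD (prod_abs m n s t) (prod_abs m k s t)).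
by congr csum; apply/funext => u; rewrite -mulrDr bmatDE.
Qed.

Fact bmulZl (c : R[i]) m n : bmul (c *: m) n = c *: bmul m n.
Proof.
apply: bmat_eqP => s t; rewrite -[RHS](csumZ c (prod_abs m n s t)).
congr csum; apply/funext => u; rewrite bmatZE [(c *: _) s u](_ : _ = c * m s u) //.
by rewrite mulrA.
Qed.

Fact bmulZr (c : R[i]) m n : bmul m (c *: n) = c *: bmul m n.
Proof.
apply: bmat_eqP => s t; rewrite -[RHS](csumZ c (prod_abs m n s t)).
congr csum; apply/funext => u; rewrite bmatZE [(c *: _) u t](_ : _ = c * n u t) //.
by rewrite mulrCA.
Qed.

Fact bstarK : involutive bstar.
Proof. by move=> m; apply: bmat_eqP => s t; exact: conjcK. Qed.

Fact bstarD : {morph bstar : m n / m + n}.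
Proof.
move=> m n; apply: bmat_eqP => s t; rewrite bmatDE.
exact: (rmorphD (@conjc R) (m t s) (n t s)).
Qed.

Fact bstarZ (c : R[i]) m : bstar (c *: m) = (c^*)%R *: bstar m.
Proof.
apply: bmat_eqP => s t; rewrite bmatZE.
exact: (rmorphM (@conjc R) c (m t s)).
Qed.

Fact bstarM m n : bstar (bmul m n) = bmul (bstar n) (bstar m).
Proof. by apply/val_inj; exact: mxstar_prod (opbound_opnorm m) (opbound_opnorm n). Qed.

Let opnormM m n : opnorm (bmul m n) <= opnorm m * opnorm n.
Proof. by apply/opnorm_le/opbound_prod; exact: opbound_opnorm. Qed.

Fact bnormM m n : `|bmul m n| <= `|m| * `|n|.
Proof. by rewrite !bmat_normE -rmorphM lecR. Qed.

Fact bnorm_cstar m : `|bmul (bstar m) m| = `|m| ^+ 2.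
Proof.
rewrite !bmat_normE -rmorphXn; congr (_%:C); apply/eqP; rewrite eq_le; apply/andP; split.
  apply: le_trans (opnormM _ _) _; rewrite expr2 ler_wpM2r ?opnorm_ge0 //.
  exact/opnorm_le/opbound_star/opbound_opnorm.
set K := opnorm (bmul _ _); have K0 : 0 <= K by exact: opnorm_ge0.
rewrite -(sqr_sqrtr K0) lerXn2r ?nnegrE ?opnorm_ge0 ?sqrtr_ge0 //.
apply: opnorm_le; apply: opbound_cstar (opbound_opnorm m) _ (sqrtr_ge0 _).
by rewrite sqr_sqrtr //; exact: opbound_opnorm.
Qed.

HB.instance Definition _ := isCStarAlgebra.Build R (bmat R T)
  bmulA bmulDl bmulDr bmulZl bmulZr bstarK bstarD bstarZ bstarM bnormM bnorm_cstar.

End bmat_norm.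

(** * Twisted point masses and regular classes *)

Section multiplier_theory.
Variables (R : realType) (G : groupType) (sigma : multiplier R G).
Implicit Types (a b c d g h k s t u : G).

Lemma mult_neq0 a b : sigma a b != 0.
Proof. by rewrite -normr_eq0 mult_norm1 oner_eq0. Qed.

Lemma nc_mult a b : nc (sigma a b) = 1.
Proof. by apply: complexI; rewrite -ncE mult_norm1. Qed.

Lemma mult_conj a b : sigma a b * conjc (sigma a b) = 1.
Proof. by rewrite mulrC -nc_sqr nc_mult expr1n. Qed.

Lemma mult_inv_sym g : sigma g^-1%g g = sigma g g^-1%g.
Proof.
have := mult_cocycle sigma g g^-1%g g.
by rewrite mulgV mulVg mult1r mult1l mulr1 mul1r.
Qed.

Section class_function.
Variable a : G.

(** The coefficient at a ^ g is that of the twisted conjugate of the point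
    mass at a by the point mass at g. *)
Definition class_fun c : R[i] :=
  if `[< exists g, c = (a ^ g)%g >] then
    let g := xget 1%g [set g | c = (a ^ g)%g] in sigma a g / sigma g c
  else 0.

Hypothesis a_regular : sigma_regular sigma a.

(** If h = k g with k in the centraliser of a, the two values differ by the
    factor sigma a k / sigma k a, which is 1 by regularity. *)
Lemma class_coef_indep g h : (a ^ g = a ^ h)%g ->
  sigma a g / sigma g (a ^ g)%g = sigma a h / sigma h (a ^ h)%g.
Proof.
move=> gh; rewrite -gh; pose k := (h * g^-1)%g.
have hE : h = (k * g)%g by rewrite mulgVK.
have kc : commute a k.
  have : (a ^ k = a)%g by rewrite conjgM -gh conjgK.
  by move=> ak; rewrite /commute -{2}ak -conjgC.
set c := (a ^ g)%g.
have gc : (g * c = a * g)%g by rewrite /c -conjgC.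
have E1 := mult_cocycle sigma a k g.
have E2 := mult_cocycle sigma k g c.
have E3 := mult_cocycle sigma k a g.
apply/eqP; rewrite eqr_div ?mult_neq0 // hE; apply/eqP.
apply: (mulIf (mult_neq0 k g)).
have -> : sigma a g * sigma (k * g)%g c * sigma k g =
  (sigma k g * sigma (k * g)%g c) * sigma a g by ring.
have -> : sigma a (k * g)%g * sigma g c * sigma k g =
  (sigma a (k * g)%g * sigma k g) * sigma g c by ring.
rewrite E2 -E1 gc (a_regular kc) (kc : (a * k = k * a)%g) E3.
by ring.
Qed.

Lemma class_funE g : class_fun (a ^ g)%g = sigma a g / sigma g (a ^ g)%g.
Proof.
rewrite /class_fun asboolT; last by exists g.
case: xgetP => [h _ /= gh|/(_ g) /(_ erefl)] //.
by rewrite (class_coef_indep gh) gh.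
Qed.

Lemma class_fun_out c : ~ (exists g, c = (a ^ g)%g) -> class_fun c = 0.
Proof. by move=> h; rewrite /class_fun asboolF. Qed.

(** Comparing coefficients, this is what commuting with the point mass at d
    means. *)
Lemma class_fun_central c d :
  class_fun c * sigma c d = sigma d (c ^ d)%g * class_fun (c ^ d)%g.
Proof.
have [[g ->]|cN] := pselect (exists g, c = (a ^ g)%g); last first.
  rewrite !class_fun_out ?mul0r ?mulr0 // => -[g cd]; apply: cN.
  by exists (g * d^-1)%g; rewrite conjgM -cd conjgK.
rewrite -conjgM !class_funE; set c2 := (a ^ (g * d))%g; set c1 := (a ^ g)%g.
have c2E : c2 = (c1 ^ d)%g by rewrite /c2 conjgM.
have gc : (g * c1 = a * g)%g by rewrite /c1 -conjgC.
have dc : (d * c2 = c1 * d)%g by rewrite c2E -conjgC.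
have E1 := mult_cocycle sigma a g d.
have E2 := mult_cocycle sigma g d c2.
have E3 := mult_cocycle sigma g c1 d.
rewrite dc in E2; rewrite gc in E3.
rewrite mulrAC mulrA; apply/eqP; rewrite eqr_div ?mult_neq0 //; apply/eqP.
apply: (mulIf (mult_neq0 g d)).
have -> : sigma a g * sigma c1 d * sigma (g * d)%g c2 * sigma g d =
  sigma a g * sigma c1 d * (sigma g d * sigma (g * d)%g c2) by ring.
have -> : sigma d c2 * sigma a (g * d)%g * sigma g c1 * sigma g d =
  sigma d c2 * sigma g c1 * (sigma a (g * d)%g * sigma g d) by ring.
rewrite E2 -E1.
have -> : sigma a g * sigma c1 d * (sigma g (c1 * d)%g * sigma d c2) =
  sigma a g * sigma d c2 * (sigma g (c1 * d)%g * sigma c1 d) by ring.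
by rewrite -E3; ring.
Qed.

End class_function.

Lemma supp_in_ell1 (u : G -> R[i]) (A : {fset G}) :
  (forall i, i \notin A -> u i = 0) -> u \in @in_ell1 R G.
Proof. by move=> /abs_le_supp/abs_le_in_ell1; rewrite unfold_in. Qed.

Lemma ell1_abs_le (f : ell1 sigma) : abs_le f (fine (ell1_norm f)).
Proof. by apply: in_ell1_abs_le; have := ell1P f; rewrite unfold_in. Qed.

Lemma ell1_eqP (f g : ell1 sigma) : (forall x, f x = g x) -> f = g.
Proof. by move=> fg; apply/val_inj/funext. Qed.

Definition delta1_fun (x : G) : R[i] := (x == 1%g)%:R.

Fact delta1_in_ell1 : delta1_fun \in @in_ell1 R G.
Proof.
apply: (supp_in_ell1 (A := [fset 1%g]%fset)) => i.
by rewrite inE /delta1_fun => /negbTE ->.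
Qed.

Definition delta1 : ell1 sigma := Ell1 sigma delta1_in_ell1.

Lemma delta1_mull (f : ell1 sigma) : amul delta1 f = f.
Proof.
apply: ell1_eqP => x.
rewrite [LHS](csum_supp (A := [fset 1%g]%fset)); last first.
  by move=> i; rewrite inE /= /delta1_fun => /negbTE ->; rewrite !mul0r.
by rewrite big_seq_fset1 /= /delta1_fun eqxx mul1r invg1 mul1g mult1l mul1r.
Qed.

Lemma delta1_mulr (f : ell1 sigma) : amul f delta1 = f.
Proof.
apply: ell1_eqP => x.
rewrite [LHS](csum_supp (A := [fset x]%fset)); last first.
  move=> i; rewrite inE /= /delta1_fun => ix.
  have [ix1|_] := eqVneq (i^-1 * x)%g 1%g; last by rewrite mulr0.
  by move: ix; rewrite -(mulVKg i x) ix1 mulg1 eqxx.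
by rewrite big_seq_fset1 /= /delta1_fun mulVg eqxx mulr1 mult1r mulr1.
Qed.

Lemma delta1_star : astar delta1 = delta1.
Proof.
apply: ell1_eqP => x; rewrite [LHS]/= /twisted_star !conjCE /= /delta1_fun.
have [->|x1] := eqVneq x 1%g.
  by rewrite invg1 eqxx mult1r conjc1 mulr1.
by rewrite -(inj_eq invg_inj) invgK invg1 (negbTE x1) conjc0 mulr0.
Qed.

Lemma mulV_bij x : bijective (fun b : G => (b^-1 * x)%g).
Proof.
exists (fun b => (x * b^-1)%g) => b; first by rewrite invgM invgK mulgA mulgV mul1g.
by rewrite invgM invgK mulgVK.
Qed.

(** The matrix of left twisted convolution by f on l2(G). *)
Definition regular_mx (f : G -> R[i]) : G -> G -> R[i] :=
  fun s t => f (s * t^-1)%g * sigma (s * t^-1)%g t.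

Fact regular_mx_bounded (f : ell1 sigma) : regular_mx f \in @in_bmat R G.
Proof.
have fM := ell1_abs_le f; apply/asboolP; exists (fine (ell1_norm f)).
have E s t : nc (regular_mx f s t) = nc (f (s * t^-1)%g).
  by rewrite ncM nc_mult mulr1.
apply: schur_test => [t B|s A|]; last exact: abs_le_ge0 fM.
- under eq_bigr => s _ do rewrite E.
  by apply: (abs_le_inj (h := fun s => (s * t^-1)%g) _ fM) => s s' /mulIg.
- under eq_bigr => t _ do rewrite E.
  apply: (abs_le_inj (h := fun t => (s * t^-1)%g) _ fM) => t t' /mulgI.
  exact: invg_inj.
Qed.

Definition regular_rep (f : ell1 sigma) : bmat R G := Bmat (regular_mx_bounded f).

(** Both products are single sums, matched termwise by the substitution u =
    b^-1 s and the cocycle identity; no interchange of summations occurs. *)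
Lemma regular_rep_star_hom : star_hom regular_rep.
Proof.
split.
- move=> k f g; apply: bmat_eqP => s t; rewrite bmatDE bmatZE.
  rewrite [LHS](_ : _ = (k * f (s * t^-1)%g + g (s * t^-1)%g) * sigma (s * t^-1)%g t) //.
  by rewrite mulrDl -mulrA.
- move=> f g; apply: bmat_eqP => s t.
  pose u b := f b * sigma b (b^-1 * (s * t^-1))%g * g (b^-1 * (s * t^-1))%g.
  rewrite [LHS](_ : _ = csum u * sigma (s * t^-1)%g t) //.
  have u1 : abs_le u (fine (ell1_norm f) * fine (ell1_norm g)).
    move=> A; have fA := ell1_abs_le f A; have g0 := abs_le_ge0 (ell1_abs_le g).
    apply: le_trans (ler_wpM2r g0 fA); rewrite mulr_suml.
    apply: ler_sum => b _; rewrite !ncM nc_mult mulr1 ler_wpM2l ?nc_ge0 //.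
    by have := ell1_abs_le g [fset (b^-1 * (s * t^-1))%g]%fset; rewrite big_seq_fset1.
  rewrite [RHS](_ : _ = csum (fun v => regular_mx f s v * regular_mx g v t)) //.
  rewrite mulrC -(csumZ _ u1) [RHS](csum_reindex _ (mulV_bij s)).
  congr csum; apply/funext => b; rewrite /u /regular_mx.
  rewrite invgM invgK !mulgA mulgV mul1g.
  have E := mult_cocycle sigma b (b^-1 * s * t^-1)%g t.
  rewrite mulgVK !mulgA mulgV mul1g in E.
  set v := (b^-1 * s * t^-1)%g in E *.
  have -> : f b * sigma b (b^-1 * s)%g * (g v * sigma v t) =
    f b * g v * (sigma b (b^-1 * s)%g * sigma v t) by ring.
  by rewrite -E; ring.
- move=> f; apply: bmat_eqP => s t; pose g := (s * t^-1)%g.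
  rewrite [LHS](_ : _ = conjc (sigma g g^-1%g) * conjc (f g^-1%g) * sigma g t) //.
  rewrite [RHS](_ : _ = conjc (f (t * s^-1)%g * sigma (t * s^-1)%g s)) //.
  have gV : (t * s^-1 = g^-1)%g by rewrite /g invgM invgK.
  have sE : s = (g * t)%g by rewrite /g mulgVK.
  rewrite gV [in RHS]sE rmorphM /=.
  have E := mult_cocycle sigma g^-1%g g t.
  rewrite mulVg mult1l mulr1 mult_inv_sym in E.
  rewrite E rmorphM /=.
  have := mult_conj g t; set x := sigma g t; set y := conjc x => xy.
  have -> : conjc (sigma g^-1%g (g * t)%g) * y * conjc (f g^-1%g) * x =
    conjc (sigma g^-1%g (g * t)%g) * conjc (f g^-1%g) * (x * y) by ring.
  by rewrite xy mulr1 mulrC.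
Qed.

End multiplier_theory.

Section class_element.
Variables (R : realType) (G : groupType) (sigma : multiplier R G) (a : G).
Hypotheses (a_regular : sigma_regular sigma a) (a_fin : finite_set (conj_class a)).

Fact class_fun_in_ell1 : class_fun sigma a \in @in_ell1 R G.
Proof.
apply: (supp_in_ell1 (A := fset_set (conj_class a))) => i iN.
apply: class_fun_out => -[g ig]; move/negP: iN; apply.
by rewrite in_fset_set // inE; exists g.
Qed.

Definition class_elt : ell1 sigma := Ell1 sigma class_fun_in_ell1.

(** The substitution b = c^-1 x in the second convolution reduces commutation
    to class_fun_central term by term. *)
Lemma class_elt_central (f : ell1 sigma) : amul class_elt f = amul f class_elt.
Proof.
apply: ell1_eqP => x.
rewrite [RHS](csum_reindex _ (mulV_bij x)).
rewrite [LHS](_ : _ = csum (fun c =>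
  class_fun sigma a c * sigma c (c^-1 * x)%g * f (c^-1 * x)%g)) //.
congr csum; apply/funext => c /=; set d := (c^-1 * x)%g.
have -> : (d^-1 * x = c ^ d)%g by rewrite conjgE /d mulVKg.
by rewrite class_fun_central // mulrC mulrA.
Qed.

Lemma class_elt_self : class_elt a = 1.
Proof.
have := class_funE a_regular 1%g; rewrite conjg1 mult1r mult1l divr1.
by [].
Qed.

End class_element.

(** * Primeness forces condition K *)

Theorem corollary2p8 (R : realType) (G : groupType) (sigma : multiplier R G)
    (A : cstarAlgType R) (iota : ell1 sigma -> A)
    (hA : full_twisted_group_cstar iota) (hprime : prime_cstar A) :
  conditionK sigma.
Proof.
move=> a areg a1 afin; have [iota_hom univ] := hA.
have [iota_lin iotaM iotaS] := iota_hom.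
pose S : set A := range iota.
have rigid (phi : A -> A) : star_hom phi -> (forall x, S x -> phi x = x) ->
    forall x, phi x = x.
  move=> phi_hom phiS x.
  have [psi [_ psi_uniq]] := univ A iota iota_hom.
  have id_hom : star_hom (@id A) by split.
  have -> : phi = psi.
    apply/esym/psi_uniq; split=> //; apply/funext => f.
    by rewrite /comp phiS //; exists f.
  by rewrite (psi_uniq id).
(* From here on e plays the role of the unit of A. *)
pose e := iota (delta1 sigma).
have es : astar e = e by rewrite -iotaS delta1_star.
have ee : amul e e = e by rewrite -iotaM delta1_mull.
have [mul1x mulx1] : (forall x, amul e x = x) /\ (forall x, amul x e = x).
  apply: (rigid_unit rigid es ee) => _ [f _ <-].
  by rewrite -!iotaM delta1_mull delta1_mulr.
have [phi [[[phi_lin _ _] phi_iota] _]] := univ _ _ (regular_rep_star_hom sigma).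
have phiZ k x : phi (k *: x) = k *: phi x.
  have phi0 : phi 0 = 0.
    have := phi_lin (-1) 0 0; rewrite scaler0 addr0 scaleN1r addNr; exact.
  by have := phi_lin k x 0; rewrite !addr0 phi0 addr0.
have phiE f : phi (iota f) = regular_rep f by rewrite -phi_iota.
have e0 : e != 0.
  apply/eqP => e0.
  have : phi e = 0 by rewrite e0 -(scale0r e) phiZ scale0r.
  rewrite phiE => /(congr1 (fun m : bmat R G => bmat_val m 1%g 1%g)) => h.
  have {}h : regular_mx sigma (delta1 sigma) 1%g 1%g = 0 by exact: h.
  move/eqP: h; rewrite /regular_mx /= /delta1_fun mulgV eqxx mult1r mulr1.
  by rewrite oner_eq0.
pose z := iota (class_elt sigma afin).
have [|x Sx|k zk] := prime_rigid_scalar rigid mul1x mulx1 (z := z) hprime e0.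
- by move=> _ [f _ <-]; exists (astar f) => //; rewrite iotaS.
- by case: Sx => f _ <-; rewrite /acomm /z -!iotaM class_elt_central.
(* The entry at (a, 1) is 1 for the class element and 0 for the unit, unless a
   = 1. *)
have := congr1 phi zk; rewrite phiZ !phiE.
move=> /(congr1 (fun m : bmat R G => bmat_val m a 1%g)) => h.
have {h} : regular_mx sigma (class_elt sigma afin) a 1%g =
  k * regular_mx sigma (delta1 sigma) a 1%g by exact: h.
rewrite /regular_mx invg1 mulg1 mult1r !mulr1 (class_elt_self areg) /= /delta1_fun.
have [a1' _|_] := eqVneq a 1%g; last by move=> /eqP; rewrite mulr0 oner_eq0.
apply: a1; rewrite a1'; apply/seteqP; split=> [x [g _ <-]|x ->].
  by rewrite conj1g.
by exists 1%g => //; rewrite conj1g.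
Qed.
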